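(* For every $w\in\mathbb N$, the $K$-vector space $\mathcal{AZ}_w$ spanned by the alternating multiple zeta values of weight $w$ and the $K$-vector space $\mathcal{AL}_w$ spanned by the alternating Carlitz multiple polylogarithms of weight $w$ are the same: $\mathcal{AZ}_w=\mathcal{AL}_w$ as subspaces of $K_\infty$.
   Context: Let $\mathbb F_q$ be a finite field with $q$ elements, $A=\mathbb F_q[\theta]$, $A_+$ the set of monic polynomials in $A$, $K=\mathbb F_q(\theta)$, $K_\infty=\mathbb F_q((1/\theta))$, $\mathbb N=\{1,2,\dots\}$. Put $\ell_0=1$ and $\ell_d=\prod_{i=1}^d(\theta-\theta^{q^i})$ for $d\ge1$. For $\mathfrak s=(s_1,\dots,s_n)\in\mathbb N^n$ and $\varepsilon=(\varepsilon_1,\dots,\varepsilon_n)\in(\mathbb F_q^\times)^n$, both of the following are said to have weight $s_1+\dots+s_n$: the alternating multiple zeta value (AMZV) $$\zeta_A\begin{pmatrix}\varepsilon\\ \mathfrak s\end{pmatrix}=\sum_{\substack{a_1,\dots,a_n\in A_+\\ \deg a_1>\dots>\deg a_n\ge 0}}\frac{\varepsilon_1^{\deg a_1}\cdots\varepsilon_n^{\deg a_n}}{a_1^{s_1}\cdots a_n^{s_n}}\in K_\infty ,$$ and the alternating Carlitz multiple polylogarithm (ACMPL) $$\mathrm{Li}\begin{pmatrix}\varepsilon\\ \mathfrak s\end{pmatrix}=\sum_{d_1>\dots>d_n\ge0}\frac{\varepsilon_1^{d_1}\cdots\varepsilon_n^{d_n}}{\ell_{d_1}^{s_1}\cdots\ell_{d_n}^{s_n}}\in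 K_\infty .$$ *)

(* Defs.v *)
From HB Require Import structures.
From mathcomp Require Import all_boot all_order all_algebra finmap generic_quotient.
From mathcomp Require Import boolp classical_sets filter topology.
From mathcomp Require summability.

Set Implicit Arguments.
Unset Strict Implicit.
Unset Printing Implicit Defensive.

Import GRing.Theory.
Local Open Scope classical_set_scope.
Local Open Scope ring_scope.
Local Open Scope quotient_scope.

(* F[[t]], used with t = 1/theta *)

Record fps (F : fieldType) := Fps { coefs : nat -> F }.

Section FpsRing.
Variable F : fieldType.
Implicit Types a b : fps F.

HB.instance Definition _ := [isNew for @coefs F].
HB.instance Definition _ := [Choice of fps F by <:].

Lemma fpsP a b : (forall n, coefs a n = coefs b n) <-> a = b.
Proof.
split=> [ab|-> //]; case: a b ab => [f] [g] /= fg; congr Fps; exact/funext.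
Qed.

Definition fps_zero := Fps (fun=> 0 : F).
Definition fps_opp a := Fps (fun n => - coefs a n).
Definition fps_add a b := Fps (fun n => coefs a n + coefs b n).

Lemma fps_addA : associative fps_add.
Proof. by move=> a b c; apply/fpsP => n /=; rewrite addrA. Qed.
Lemma fps_addC : commutative fps_add.
Proof. by move=> a b; apply/fpsP => n /=; rewrite addrC. Qed.
Lemma fps_add0 : left_id fps_zero fps_add.
Proof. by move=> a; apply/fpsP => n /=; rewrite add0r. Qed.
Lemma fps_addN : left_inverse fps_zero fps_opp fps_add.
Proof. by move=> a; apply/fpsP => n /=; rewrite addNr. Qed.

HB.instance Definition _ :=
  GRing.isZmodule.Build (fps F) fps_addA fps_addC fps_add0 fps_addN.

Lemma coefs0 n : coefs (0 : fps F) n = 0. Proof. by []. Qed.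
Lemma coefsD a b n : coefs (a + b) n = coefs a n + coefs b n.
Proof. by []. Qed.
Lemma coefsN a n : coefs (- a) n = - coefs a n. Proof. by []. Qed.
Lemma coefsB a b n : coefs (a - b) n = coefs a n - coefs b n.
Proof. by []. Qed.

Definition fpsC (c : F) := Fps (fun n => if n == 0%N then c else 0).

Definition fps_mul a b :=
  Fps (fun n => \sum_(i < n.+1) coefs a i * coefs b (n - i)).

(* Truncation to a polynomial, to transfer the ring axioms from {poly F} *)
Definition fps_trunc (m : nat) a : {poly F} := \poly_(i < m) coefs a i.

Lemma coef_mul_ext (p p' q q' : {poly F}) n :
  (forall i, (i <= n)%N -> p`_i = p'`_i) ->
  (forall i, (i <= n)%N -> q`_i = q'`_i) -> (p * q)`_n = (p' * q')`_n.
Proof.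
move=> pp' qq'; rewrite !coefM; apply: eq_bigr => i _.
by rewrite pp' ?qq' ?leq_subr // -ltnS.
Qed.

Lemma coefs_mul_trunc m a b n : (n < m)%N ->
  coefs (fps_mul a b) n = (fps_trunc m a * fps_trunc m b)`_n.
Proof.
move=> nm; rewrite coefM; apply: eq_bigr => i _.
have i_m : (i < m)%N by exact: leq_trans (ltn_ord i) nm.
by rewrite !coef_poly i_m (leq_ltn_trans (leq_subr _ _) nm).
Qed.

Lemma coef_trunc_mul m a b n : (n < m)%N ->
  (fps_trunc m (fps_mul a b))`_n = (fps_trunc m a * fps_trunc m b)`_n.
Proof. by move=> nm; rewrite coef_poly nm (coefs_mul_trunc _ _ nm). Qed.

Lemma fps_mulA : associative fps_mul.
Proof.
move=> a b c; apply/fpsP => n; rewrite !(@coefs_mul_trunc n.+1) //.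
rewrite (@coef_mul_ext _ (fps_trunc n.+1 a) _
           (fps_trunc n.+1 b * fps_trunc n.+1 c)) //; last first.
  by move=> i i_n; rewrite coef_trunc_mul.
rewrite mulrA; apply: coef_mul_ext => // i i_n.
by rewrite coef_trunc_mul.
Qed.

Lemma fps_mulC : commutative fps_mul.
Proof.
by move=> a b; apply/fpsP => n; rewrite !(@coefs_mul_trunc n.+1) // mulrC.
Qed.

Lemma fps_mulCE c a n : coefs (fps_mul (fpsC c) a) n = c * coefs a n.
Proof.
rewrite /= big_ord_recl /= subn0 big1 ?addr0 // => i _.
by rewrite mul0r.
Qed.

Lemma fps_mul1 : left_id (fpsC 1) fps_mul.
Proof. by move=> a; apply/fpsP => n; rewrite fps_mulCE mul1r. Qed.

Lemma fps_mulDl : left_distributive fps_mul +%R.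
Proof.
move=> a b c; apply/fpsP => n /=; rewrite -big_split /=.
by apply: eq_bigr => i _; rewrite mulrDl.
Qed.

Lemma fps_one_neq0 : fpsC 1 != 0.
Proof.
by apply/eqP => /fpsP /(_ 0%N) /eqP; rewrite oner_eq0.
Qed.

HB.instance Definition _ := GRing.Zmodule_isComNzRing.Build (fps F)
  fps_mulA fps_mulC fps_mul1 fps_mulDl fps_one_neq0.

Lemma coefs1 n : coefs (1 : fps F) n = (n == 0%N)%:R.
Proof. by rewrite /=; case: eqP. Qed.
Lemma coefsM a b n :
  coefs (a * b) n = \sum_(i < n.+1) coefs a i * coefs b (n - i).
Proof. by []. Qed.
Lemma coefsCM c a n : coefs (fpsC c * a) n = c * coefs a n.
Proof. exact: fps_mulCE. Qed.

Definition fps_unit : pred (fps F) := fun a => `[< exists b, b * a = 1 >].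
Definition fps_inv a : fps F :=
  if pselect (exists b, b * a = 1) is left h then projT1 (cid h) else a.

Lemma fps_mulVr : {in fps_unit, left_inverse 1 fps_inv *%R}.
Proof.
move=> a /asboolP ua; rewrite /fps_inv.
by case: pselect => [h|/(_ ua)//]; exact: projT2 (cid h).
Qed.
Lemma fps_unitP a b : b * a = 1 -> fps_unit a.
Proof. by move=> ba; apply/asboolP; exists b. Qed.
Lemma fps_inv_out : {in [predC fps_unit], fps_inv =1 id}.
Proof.
move=> a; rewrite inE => /asboolP na; rewrite /fps_inv.
by case: pselect => // h; case: (na h).
Qed.

HB.instance Definition _ := GRing.ComNzRing_hasMulInverse.Build (fps F)
  fps_mulVr fps_unitP fps_inv_out.

Lemma fps_neq0_ord a : a != 0 ->
  exists n, coefs a n != 0 /\ forall i, (i < n)%N -> coefs a i = 0.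
Proof.
move=> a0; have exa : exists n, coefs a n != 0.
  apply/not_existsP => aE; move/eqP: a0; apply; apply/fpsP => n.
  by apply/eqP; apply/negPn/negP/aE.
case: (ex_minnP exa) => n an nmin; exists n; split=> // i i_n.
by apply/eqP; apply: contraTT i_n => /nmin; rewrite -leqNgt.
Qed.

Lemma fps_mulf_eq0 a b : a * b = 0 -> (a == 0) || (b == 0).
Proof.
move=> ab0; apply/norP => -[/fps_neq0_ord [n [an amin]]].
move=> /fps_neq0_ord [m [bm bmin]].
have := congr1 (fun u => coefs u (n + m)%N) ab0.
have ltn : (n < (n + m).+1)%N by rewrite ltnS leq_addr.
rewrite coefsM coefs0 (bigD1 (Ordinal ltn)) //= addKn big1 => [|i].
  by apply/eqP; rewrite addr0 mulf_neq0.
rewrite -val_eqE neq_ltn /= => /orP[/amin ->|ni]; first by rewrite mul0r.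
rewrite bmin ?mulr0 // ltn_subLR; last by rewrite -ltnS.
by rewrite ltn_add2r.
Qed.

HB.instance Definition _ :=
  GRing.ComUnitRing_isIntegral.Build (fps F) fps_mulf_eq0.

Lemma fpsC_is_zmod_morphism : zmod_morphism fpsC.
Proof.
by move=> x y; apply/fpsP => n; rewrite coefsB /=; case: eqP; rewrite ?subr0.
Qed.
Lemma fpsC_is_monoid_morphism : monoid_morphism fpsC.
Proof.
split=> // x y; apply/fpsP => n; rewrite coefsCM /=.
by case: eqP; rewrite ?mulr0.
Qed.
HB.instance Definition _ :=
  GRing.isZmodMorphism.Build F (fps F) fpsC fpsC_is_zmod_morphism.
HB.instance Definition _ :=
  GRing.isMonoidMorphism.Build F (fps F) fpsC fpsC_is_monoid_morphism.

Definition fpsX : fps F := Fps (fun n => (n == 1%N)%:R).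

Lemma coefsXM a n : coefs (fpsX * a) n = if n is m.+1 then coefs a m else 0.
Proof.
rewrite coefsM; case: n => [|n]; first by rewrite big_ord1 mul0r.
rewrite 2!big_ord_recl /= mul0r add0r mul1r subSS subn0 big1 ?addr0 //.
by move=> i _; rewrite mul0r.
Qed.

Lemma coefsXnM k a n :
  coefs (fpsX ^+ k * a) n = if (n < k)%N then 0 else coefs a (n - k).
Proof.
elim: k n => [|k IH] n; first by rewrite expr0 mul1r subn0.
by rewrite exprS -mulrA coefsXM; case: n => // n; rewrite IH ltnS subSS.
Qed.

Lemma coefsXn k n : coefs (fpsX ^+ k) n = (n == k)%:R.
Proof.
rewrite -[fpsX ^+ k]mulr1 coefsXnM coefs1; case: ltngtP => [//|kn|->].
  by rewrite subn_eq0 leqNgt kn.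
by rewrite subnn.
Qed.

Lemma coefs_sum (I : Type) (r : seq I) (P : pred I) (f : I -> fps F) n :
  coefs (\sum_(i <- r | P i) f i) n = \sum_(i <- r | P i) coefs (f i) n.
Proof. by elim/big_rec2: _ => // i u v _ <-; rewrite coefsD. Qed.

Lemma fpsX_neq0 : fpsX != 0.
Proof. by apply/eqP => /fpsP /(_ 1%N) /eqP; rewrite oner_eq0. Qed.

End FpsRing.

Lemma fracE (R : idomainType) (x : {fraction R}) :
  x = FracField.tofrac \n_(repr x) / FracField.tofrac \d_(repr x).
Proof.
have d0 := denom_ratioP (repr x).
suff xd : x * FracField.tofrac \d_(repr x) = FracField.tofrac \n_(repr x).
  by rewrite -xd mulfK // tofrac_eq0.
move: d0; rewrite -{2}[x]reprK; move: (repr x) => y y0.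
unlock FracField.tofrac; rewrite -[LHS]FracField.pi_mul.
apply/eqmodP; rewrite /= FracField.equivfE /FracField.mulf.
by rewrite !numden_Ratio ?oner_eq0 ?mulr1 // mulrC.
Qed.

Section FracLift.
Variables (R : idomainType) (L : fieldType) (f : {rmorphism R -> L}).
Hypothesis f_eq0 : forall p, (f p == 0) = (p == 0).
Local Notation frac := (@FracField.tofrac R).

Definition frac_lift (x : {fraction R}) : L := f \n_(repr x) / f \d_(repr x).

Lemma frac_lift_div p q : q != 0 -> frac_lift (frac p / frac q) = f p / f q.
Proof.
move=> q0; rewrite /frac_lift; have := fracE (frac p / frac q).
set r := repr _; have d0 := denom_ratioP r => /eqP.
rewrite eqr_div ?tofrac_eq0 // -!tofracM tofrac_eq => /eqP e.
by apply/eqP; rewrite eqr_div ?f_eq0 // -!rmorphM e.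
Qed.

Lemma fracP (x : {fraction R}) :
  exists p q, q != 0 /\ x = frac p / frac q.
Proof.
exists \n_(repr x), \d_(repr x); split; [exact: denom_ratioP | exact: fracE].
Qed.

Lemma frac_lift_frac p : frac_lift (frac p) = f p.
Proof.
have := @frac_lift_div p 1 (oner_neq0 _).
by rewrite tofrac1 rmorph1 !divr1.
Qed.

Lemma frac_lift_is_zmod_morphism : zmod_morphism frac_lift.
Proof.
move=> x y; have [p [q [q0 ->]]] := fracP x; have [p' [q' [q'0 ->]]] := fracP y.
rewrite -mulNr addf_div ?tofrac_eq0 // -tofracN -!tofracM -tofracD.
rewrite !frac_lift_div ?mulf_neq0 // -mulNr addf_div ?f_eq0 //.
by rewrite rmorphD !rmorphM rmorphN.
Qed.

Lemma frac_lift_is_monoid_morphism : monoid_morphism frac_lift.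
Proof.
split=> [|x y]; first by rewrite -tofrac1 frac_lift_frac rmorph1.
have [p [q [q0 ->]]] := fracP x; have [p' [q' [q'0 ->]]] := fracP y.
by rewrite mulf_div -!tofracM !frac_lift_div ?mulf_neq0 // !rmorphM mulf_div.
Qed.

End FracLift.

(* K = F(theta); A is {poly F}, with 'X in the role of theta *)
Definition K (F : fieldType) : Type := {fraction {poly F}}.
HB.instance Definition _ F := GRing.Field.on (K F).

Definition toK (F : fieldType) (a : {poly F}) : K F :=
  FracField.tofrac a.

(* K_oo = F((1/theta)), as the fraction field of F[[t]] with t = 1/theta *)
Definition Kinf (F : fieldType) : Type := {fraction (fps F)}.
HB.instance Definition _ F := GRing.Field.on (Kinf F).

HB.instance Definition _ (F : fieldType) := isPointed.Build (Kinf F) 0.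

Definition fpsK (F : fieldType) (u : fps F) : Kinf F :=
  FracField.tofrac u.

Section Kinf.
Variable F : fieldType.

HB.instance Definition _ :=
  GRing.RMorphism.copy (@toK F) (@FracField.tofrac {poly F}).
HB.instance Definition _ :=
  GRing.RMorphism.copy (@fpsK F) (@FracField.tofrac (fps F)).

Definition theta : Kinf F := (fpsK (fpsX F))^-1.

(* The inclusion of A in K_oo: evaluation at theta *)
Definition AtoKinf (p : {poly F}) : Kinf F :=
  (map_poly (@fpsK F \o @fpsC F) p).[theta].

Lemma AtoKinf_is_zmod_morphism : zmod_morphism AtoKinf.
Proof. by move=> p q; rewrite /AtoKinf rmorphB hornerD hornerN. Qed.
Lemma AtoKinf_is_monoid_morphism : monoid_morphism AtoKinf.
Proof.
by split=> [|p q]; rewrite /AtoKinf ?rmorph1 ?hornerC // rmorphM hornerM.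
Qed.
HB.instance Definition _ :=
  GRing.isZmodMorphism.Build {poly F} (Kinf F) AtoKinf AtoKinf_is_zmod_morphism.
HB.instance Definition _ := GRing.isMonoidMorphism.Build {poly F} (Kinf F)
  AtoKinf AtoKinf_is_monoid_morphism.

Lemma AtoKinf_eq0 p : (AtoKinf p == 0) = (p == 0).
Proof.
apply/idP/idP => [|/eqP ->]; last by rewrite rmorph0.
apply: contraLR => p0.
have X0 : fpsK (fpsX F) != 0 by rewrite tofrac_eq0 fpsX_neq0.
pose n := (size p).-1.
pose u : fps F := \sum_(i < n.+1) fpsC p`_i * fpsX F ^+ (n - i).
have uE : fpsK u = AtoKinf p * fpsK (fpsX F) ^+ n.
  rewrite /AtoKinf (@horner_coef_wide _ n.+1); last first.
    by rewrite (leq_trans (size_poly _ _)) // leqSpred.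
  rewrite rmorph_sum mulr_suml; apply: eq_bigr => i _.
  rewrite rmorphM rmorphXn coef_map /= -mulrA; congr (_ * _).
  have -> : fpsK (fpsX F) ^+ n = fpsK (fpsX F) ^+ (n - i) * fpsK (fpsX F) ^+ i.
    by rewrite -exprD subnK // leq_ord.
  by rewrite /theta exprVn mulrC mulfK ?expf_neq0.
have : u != 0.
  apply/eqP => /fpsP /(_ 0%N); rewrite coefs0 => /eqP; apply/negP.
  have -> : coefs u 0 = p`_n.
    rewrite coefs_sum big_ord_recr coefsCM coefsXn subnn mulr1.
    rewrite big1 => [|i _]; first exact: add0r.
    by rewrite coefsCM coefsXn eq_sym subn_eq0 leqNgt /= ltn_ord mulr0.
  by rewrite -lead_coefE lead_coef_eq0.
apply: contraNneq => pE; rewrite pE mul0r in uE.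
move/eqP: uE; rewrite tofrac_eq0; exact: id.
Qed.

(* The inclusion of K in K_oo *)
Definition KtoKinf : K F -> Kinf F := frac_lift AtoKinf.

HB.instance Definition _ := GRing.isZmodMorphism.Build (K F) (Kinf F) KtoKinf
  (frac_lift_is_zmod_morphism AtoKinf_eq0).
HB.instance Definition _ := GRing.isMonoidMorphism.Build (K F) (Kinf F) KtoKinf
  (frac_lift_is_monoid_morphism AtoKinf_eq0).

Lemma KtoKinf_toK p : KtoKinf (toK p) = AtoKinf p.
Proof. exact: (frac_lift_frac AtoKinf_eq0). Qed.

Definition Kinf_scale (c : K F) (x : Kinf F) : Kinf F := KtoKinf c * x.

Lemma Kinf_scaleA c d x : Kinf_scale c (Kinf_scale d x) = Kinf_scale (c * d) x.
Proof. by rewrite /Kinf_scale rmorphM mulrA. Qed.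
Lemma Kinf_scale1 : left_id 1 Kinf_scale.
Proof. by move=> x; rewrite /Kinf_scale rmorph1 mul1r. Qed.
Lemma Kinf_scaleDr : right_distributive Kinf_scale +%R.
Proof. by move=> c x y; rewrite /Kinf_scale mulrDr. Qed.
Lemma Kinf_scaleDl x : {morph Kinf_scale^~ x : c d / c + d}.
Proof. by move=> c d; rewrite /Kinf_scale rmorphD mulrDl. Qed.

HB.instance Definition _ := GRing.Zmodule_isLmodule.Build (K F) (Kinf F)
  Kinf_scaleA Kinf_scale1 Kinf_scaleDr Kinf_scaleDl.

Lemma Kinf_scaleE (c : K F) (x : Kinf F) : c *: x = KtoKinf c * x.
Proof. by []. Qed.

(* The (1/theta)-adic topology: the basic neighbourhoods of x are
   x + t^N F[[t]], the balls for the absolute value at infinity *)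
Definition Kinf_ball (N : nat) (x : Kinf F) : set (Kinf F) :=
  [set y | exists u : fps F, y - x = fpsK (fpsX F ^+ N * u)].

Definition Kinf_nbhs (x : Kinf F) : set_system (Kinf F) :=
  filter_from setT (fun N => Kinf_ball N x).

HB.instance Definition _ := hasNbhs.Build (Kinf F) Kinf_nbhs.

Lemma Kinf_ball_refl N x : Kinf_ball N x x.
Proof. by exists 0; rewrite mulr0 rmorph0 subrr. Qed.

Lemma Kinf_ball_sym N x y : Kinf_ball N x y -> Kinf_ball N y x.
Proof. by move=> [u yx]; exists (- u); rewrite mulrN rmorphN -opprB yx. Qed.

Lemma Kinf_ball_trans N x y z :
  Kinf_ball N x y -> Kinf_ball N y z -> Kinf_ball N x z.
Proof.
move=> [u yx] [v zy]; exists (u + v).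
by rewrite -(subrKA y) zy yx mulrDr rmorphD addrC.
Qed.

Lemma Kinf_ball_le M N x : (N <= M)%N -> Kinf_ball M x `<=` Kinf_ball N x.
Proof.
move=> NM y [u yx]; exists (fpsX F ^+ (M - N) * u).
by rewrite mulrA -exprD subnKC.
Qed.

Lemma Kinf_nbhs_filter (x : Kinf F) : ProperFilter (nbhs x).
Proof.
apply: filter_from_proper; last by move=> N _; exists x; exact: Kinf_ball_refl.
apply: filter_fromT_filter; first by exists 0%N.
move=> M N; exists (maxn M N) => y xy.
by split; apply: Kinf_ball_le xy; rewrite ?leq_maxl ?leq_maxr.
Qed.

Lemma Kinf_nbhs_singleton (x : Kinf F) (S : set (Kinf F)) : nbhs x S -> S x.
Proof. by move=> [N _]; apply; exact: Kinf_ball_refl. Qed.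

Lemma Kinf_nbhs_nbhs (x : Kinf F) (S : set (Kinf F)) :
  nbhs x S -> nbhs x (nbhs^~ S).
Proof.
move=> [N _ NS]; exists N => // y xy; exists N => // z yz.
by apply: NS; exact: Kinf_ball_trans xy yz.
Qed.

HB.instance Definition _ := Nbhs_isNbhsTopological.Build (Kinf F)
  Kinf_nbhs_filter Kinf_nbhs_singleton Kinf_nbhs_nbhs.

Lemma Kinf_ball_eq x y : (forall N, Kinf_ball N x y) -> x = y.
Proof.
move=> xy; have [p [q [q0 zE]]] := fracP (y - x).
have fq0 : FracField.tofrac q != 0 by rewrite tofrac_eq0.
have p0 : p = 0.
  apply/fpsP => n; have [u yx] := xy n.+1.
  have : FracField.tofrac p = FracField.tofrac (fpsX F ^+ n.+1 * u * q).
    rewrite [RHS]tofracM -[X in X * _]/(fpsK _) -yx zE.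
    by rewrite -[RHS]mulrA mulVf // mulr1.
  move=> /eqP; rewrite tofrac_eq => /eqP ->.
  by rewrite -mulrA coefsXnM ltnSn coefs0.
move: zE; rewrite p0 tofrac0 => zE.
by apply/esym/eqP; rewrite -subr_eq0 zE; apply/eqP; exact: mul0r.
Qed.

Lemma Kinf_hausdorff : hausdorff_space (Kinf F).
Proof.
move=> x y xy; apply: Kinf_ball_eq => N.
have [] := xy (Kinf_ball N x) (Kinf_ball N y); [by exists N | by exists N |].
move=> z [xz yz]; exact: Kinf_ball_trans xz (Kinf_ball_sym yz).
Qed.

End Kinf.

(* Unordered sum of a family: the limit of its finite partial sums along the
   directed set of finite subsets of the index type *)
Definition Kinf_sum (F : fieldType) (I : choiceType) (x : I -> Kinf F) :
    Kinf F :=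
  lim (summability.partial_sum x @ summability.totally).

Definition linear_span (R : pzRingType) (V : lmodType R) (S : set V) : set V :=
  [set v | exists (m : nat) (c : 'I_m -> R) (x : 'I_m -> V),
     (forall i, S (x i)) /\ v = \sum_(i < m) c i *: x i].

Section Values.
Variable F : finFieldType.

Definition deg (a : {poly F}) : nat := (size a).-1.

Definition ell (d : nat) : {poly F} :=
  \prod_(1 <= i < d.+1) ('X - 'X^(#|F| ^ i)).

Section Depth.
Variable n : nat.
Variables (eps : 'I_n -> F) (s : 'I_n -> nat).

Definition zeta_pred (a : {ffun 'I_n -> {poly F}}) : bool :=
  [forall i, a i \is monic] &&
  [forall i : 'I_n, forall j : 'I_n, (i < j)%N ==> (deg (a j) < deg (a i))%N].

Definition zeta_index := {a : {ffun 'I_n -> {poly F}} | zeta_pred a}.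
HB.instance Definition _ := Choice.on zeta_index.

Definition zeta_term (a : zeta_index) : K F :=
  \prod_(i < n) (toK (eps i ^+ deg (sval a i))%:P / toK (sval a i) ^+ s i).

Definition AMZV : Kinf F := Kinf_sum (fun a : zeta_index => KtoKinf (zeta_term a)).

Definition Li_pred (d : {ffun 'I_n -> nat}) : bool :=
  [forall i : 'I_n, forall j : 'I_n, (i < j)%N ==> (d j < d i)%N].

Definition Li_index := {d : {ffun 'I_n -> nat} | Li_pred d}.
HB.instance Definition _ := Choice.on Li_index.

Definition Li_term (d : Li_index) : K F :=
  \prod_(i < n) (toK (eps i ^+ sval d i)%:P / toK (ell (sval d i)) ^+ s i).

Definition ACMPL : Kinf F := Kinf_sum (fun d : Li_index => KtoKinf (Li_term d)).

End Depth.

(* n = 0 forces w = 0, so it is excluded by any w > 0 *)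
Definition admissible (w n : nat) (eps : 'I_n -> F) (s : 'I_n -> nat) : Prop :=
  [/\ forall i, eps i != 0, forall i, (0 < s i)%N & (\sum_(i < n) s i)%N = w].

Definition AZ (w : nat) : set (Kinf F) :=
  linear_span [set z | exists n (eps : 'I_n -> F) (s : 'I_n -> nat),
                         admissible w eps s /\ z = AMZV eps s].

Definition AL (w : nat) : set (Kinf F) :=
  linear_span [set z | exists n (eps : 'I_n -> F) (s : 'I_n -> nat),
                         admissible w eps s /\ z = ACMPL eps s].

End Values.

Arguments AZ F w : clear implicits.
Arguments AL F w : clear implicits.

(* Main.v *)
Require Import Defs.
From mathcomp Require Import all_boot all_order all_algebra.
From mathcomp Require Import boolp classical_sets.
From mathcomp Require Import finfield finmap filter topology.
From mathcomp Require Import zify ring.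
From mathcomp Require summability.

(* Write S_d(k) for the sum of a^-k over the monic a of degree d, and let q be
   the number of elements of F.  Both kinds of values are limits, as N grows, of
   sums over N > d_1 > ... > d_n of products of eps_i^(d_i) X(s_i, d_i), with
   X(s, d) = S_d(s) for the AMZVs and X(s, d) = ell_d^-s for the ACMPLs.  It is
   enough to compare the K-spans of these truncated sums, as functions of N.
   The monic a of degree d are the zeros of 1 - E_d, where
   E_d(x) = sum_j x^(q^j) / (D_j ell_(d-j)^(q^j)) is the Carlitz polynomial, and
   the logarithmic derivative of 1 - E_d yields the recursion
   S_d(k) = sum_(q^j < k) S_d(k - q^j) / (D_j ell_(d-j)^(q^j)).
   For j > 0 the shifted power ell_(d-j)^(-q^j) is itself a combination of
   truncated ACMPL summands at d with leading exponent smaller than q^j; this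
   comes from ell_d^-q = (theta - theta^q) ell_(d+1)^-1 sum_(i <= d) ell_i^(1-q),
   raised to powers of q, and from the stuffle product.  Therefore
   S_d(k) = ell_d^-k + (summands of weight k with leading exponent < k): the
   change of functions X is unitriangular, and the two spans coincide. *)

Set Implicit Arguments.
Unset Strict Implicit.
Unset Printing Implicit Defensive.

Import GRing.Theory.
Local Open Scope ring_scope.

(** * Spans of nested sums *)

Section NestedSums.
Variables (F L : fieldType) (h : {rmorphism F -> L}).
Implicit Types (X : nat -> nat -> L) (f g : nat -> L) (y : nat -> L).

(** Functions of the truncation bound [d], graded by weight. The coefficients [c] do not depend on
    [d], which is what lets relations between such functions pass to the limit. *)
Inductive nested X : nat -> (nat -> L) -> Prop :=
| nested_one : nested X 0 (fun=> 1)
| nested_zero w : nested X w (fun=> 0)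
| nested_lin w c f g : nested X w f -> nested X w g ->
    nested X w (fun d => c * f d + g d)
| nested_sum w e s f : e != 0 -> (0 < s)%N -> nested X w f ->
    nested X (s + w) (fun d => \sum_(j < d) h (e ^+ j) * X s j * f j).

(* Combinations of the summands [e ^ d * X s d * f d] with leading exponent
   [s <= m]. *)
Inductive summand X (m : nat) : nat -> (nat -> L) -> Prop :=
| summand_zero w : summand X m w (fun=> 0)
| summand_lin w c f g : summand X m w f -> summand X m w g ->
    summand X m w (fun d => c * f d + g d)
| summand_gen w e s f : e != 0 -> (0 < s <= m)%N -> nested X w f ->
    summand X m (s + w) (fun d => h (e ^+ d) * X s d * f d).

Lemma nested_eq X w w' f g : nested X w f -> w = w' -> f =1 g -> nested X w' g.
Proof. by move=> + <- /funext <-. Qed.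

Lemma summand_eq X m w w' f g :
  summand X m w f -> w = w' -> f =1 g -> summand X m w' g.
Proof. by move=> + <- /funext <-. Qed.

Lemma nestedD X w f g :
  nested X w f -> nested X w g -> nested X w (fun d => f d + g d).
Proof.
by move=> uf ug; apply: (nested_eq (nested_lin 1 uf ug)) => // d; rewrite mul1r.
Qed.

Lemma summandD X m w f g :
  summand X m w f -> summand X m w g -> summand X m w (fun d => f d + g d).
Proof.
move=> uf ug; apply: (summand_eq (summand_lin 1 uf ug)) => // d.
by rewrite mul1r.
Qed.

Lemma summandZ X m w c f : summand X m w f -> summand X m w (fun d => c * f d).
Proof.
move=> uf; apply: (summand_eq (summand_lin c uf (summand_zero X m w))) => // d.
by rewrite addr0.
Qed.

Lemma summand_bigsum X m w (I : Type) (r : seq I) (P : pred I)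
    (f : I -> nat -> L) :
  (forall i, P i -> summand X m w (f i)) ->
  summand X m w (fun d => \sum_(i <- r | P i) f i d).
Proof.
move=> uf; elim: r => [|i r IH].
  by apply: (summand_eq (summand_zero X m w)) => // d; rewrite big_nil.
have [Pi|nPi] := boolP (P i).
  by apply: (summand_eq (summandD (uf _ Pi) IH)) => // d; rewrite big_cons Pi.
by apply: (summand_eq IH) => // d; rewrite big_cons (negbTE nPi).
Qed.

Lemma summand_le X m m' w f :
  (m <= m')%N -> summand X m w f -> summand X m' w f.
Proof.
move=> mm'; elim=> {w f} [w|w c f g _ uf _ ug|w e s f e0 /andP[s0 sm] uf].
- exact: summand_zero.
- exact: summand_lin.
- by apply: summand_gen => //; rewrite s0 (leq_trans sm).
Qed.

Lemma summand_sum X m w f :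
  summand X m w f -> nested X w (fun d => \sum_(j < d) f j).
Proof.
elim=> {w f} [w|w c f g _ uf _ ug|w e s f e0 /andP[s0 _] uf].
- by apply: (nested_eq (nested_zero X w)) => // d; rewrite big1.
- apply: (nested_eq (nested_lin c uf ug)) => // d.
  by rewrite mulr_sumr -big_split.
- exact: nested_sum.
Qed.

Lemma summand_twist X m w e f : e != 0 -> summand X m w f ->
  summand X m w (fun d => h (e ^+ d) * f d).
Proof.
move=> e0; elim=> {w f} [w|w c f g _ uf _ ug|w e' s f e'0 sm uf].
- by apply: (summand_eq (summand_zero X m w)) => // d; rewrite mulr0.
- by apply: (summand_eq (summand_lin c uf ug)) => // d; ring.
- apply: (summand_eq (summand_gen (mulf_neq0 e0 e'0) sm uf)) => // d.
  by rewrite exprMn rmorphM !mulrA.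
Qed.

(** The pairs of indices below [d] are split according to which index is larger, with the diagonal
    apart: the stuffle of two outermost sums. *)
Lemma sum_mul_sum f g d : (\sum_(j < d) f j) * (\sum_(j < d) g j) =
  \sum_(j < d) f j * (\sum_(i < j) g i) + \sum_(j < d) g j * (\sum_(i < j) f i)
  + \sum_(j < d) f j * g j.
Proof.
elim: d => [|d IH]; first by rewrite !big_ord0; ring.
by rewrite !big_ord_recr /= mulrDl !mulrDr IH; ring.
Qed.

Definition powers y s d := y d ^+ s.

(** Stuffle product. The diagonal part keeps its form because exponents of [y] add and twists
    multiply; the induction runs on the first factor, then on the second. *)
Lemma nestedM y a b f g : nested (powers y) a f -> nested (powers y) b g ->
  nested (powers y) (a + b) (fun d => f d * g d).
Proof.
move=> uf; elim: uf b g => {a f} [|w|w c f f' _ IHf _ IHf'|w e s f e0 s0 uf IHf] b g ug.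
- by apply: (nested_eq ug) => // d; rewrite mul1r.
- by apply: (nested_eq (nested_zero _ (w + b))) => // d; rewrite mul0r.
- by apply: (nested_eq (nested_lin c (IHf _ _ ug) (IHf' _ _ ug))) => // d; ring.
have usf := nested_sum e0 s0 uf.
elim: ug => {b g} [|b|b c g g' _ IHg _ IHg'|b e' s' g e'0 s'0 ug IHg].
- by apply: (nested_eq usf) => [|d]; rewrite ?addn0 // mulr1.
- by apply: (nested_eq (nested_zero _ (s + w + b))) => // d; rewrite mulr0.
- by apply: (nested_eq (nested_lin c IHg IHg')) => // d; ring.
pose G d := \sum_(j < d) h (e' ^+ j) * powers y s' j * g j.
have u1 := nested_sum e0 s0 (IHf _ _ (nested_sum e'0 s'0 ug)).
have u2 := nested_sum e'0 s'0 IHg.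
have u3 := nested_sum (mulf_neq0 e0 e'0) (ltn_addr s' s0) (IHf _ _ ug).
have e1 : (s + (w + (s' + b)) = s + w + (s' + b))%N by lia.
have e2 : (s' + (s + w + b) = s + w + (s' + b))%N by lia.
have e3 : (s + s' + (w + b) = s + w + (s' + b))%N by lia.
rewrite e1 in u1; rewrite e2 in u2; rewrite e3 in u3.
apply: (nested_eq (nestedD (nestedD u1 u2) u3)) => // d.
rewrite [RHS](sum_mul_sum (fun j => h (e ^+ j) * powers y s j * f j)
  (fun j => h (e' ^+ j) * powers y s' j * g j)).
congr (_ + _ + _); apply: eq_bigr => j _ /=; rewrite ?mulrA //.
  by rewrite -!mulrA; congr (_ * (_ * _)); rewrite mulrC.
by rewrite /powers exprD exprMn rmorphM; ring.
Qed.

Lemma summand_nestedM y m a b f g :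
  summand (powers y) m a f -> nested (powers y) b g ->
  summand (powers y) m (a + b) (fun d => f d * g d).
Proof.
move=> uf ug; elim: uf => {a f} [w|w c f f' _ IHf _ IHf'|w e s f e0 s0 uf].
- by apply: (summand_eq (summand_zero _ m (w + b))) => // d; rewrite mul0r.
- by apply: (summand_eq (summand_lin c IHf IHf')) => // d; ring.
by apply: (summand_eq (summand_gen e0 s0 (nestedM uf ug))) => [|d]; rewrite ?addnA ?mulrA.
Qed.

(** Both leading factors sit at the same index [d], so the leading exponents add; the tails are
    multiplied by [nestedM]. *)
Lemma summandM y m n a b f g :
  summand (powers y) m a f -> summand (powers y) n b g ->
  summand (powers y) (m + n) (a + b) (fun d => f d * g d).
Proof.
move=> uf ug; elim: uf => {a f} [w|w c f f' _ IHf _ IHf'|w e s f e0 s0 uf].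
- by apply: (summand_eq (summand_zero _ _ (w + b))) => // d; rewrite mul0r.
- by apply: (summand_eq (summand_lin c IHf IHf')) => // d; ring.
elim: ug => {b g} [b|b c g g' _ IHg _ IHg'|b e' s' g e'0 s'0 ug].
- by apply: (summand_eq (summand_zero _ _ (s + w + b))) => // d; rewrite mulr0.
- by apply: (summand_eq (summand_lin c IHg IHg')) => // d; ring.
have ss : (0 < s + s' <= m + n)%N by lia.
apply: (summand_eq (summand_gen (mulf_neq0 e0 e'0) ss (nestedM uf ug))) => [|d].
  by lia.
by rewrite /powers exprD exprMn rmorphM; ring.
Qed.

Lemma summandX y m a f n : (0 < n)%N -> summand (powers y) m a f ->
  summand (powers y) (m * n) (a * n) (fun d => f d ^+ n).
Proof.
move=> + uf; elim: n => // -[|n] IH _; first by rewrite !muln1.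
rewrite (mulnS m n.+1) (mulnS a n.+1).
by apply: (summand_eq (summandM uf (IH isT))) => // d; rewrite exprS.
Qed.

Lemma summand_powers y s : (0 < s)%N ->
  summand (powers y) s s (fun d => y d ^+ s).
Proof.
move=> s0; have s1 : (0 < s <= s)%N by rewrite s0 /=.
apply: (summand_eq (summand_gen (oner_neq0 F) s1 (nested_one _))) => [|d].
  by rewrite addn0.
by rewrite expr1n rmorph1 mul1r mulr1.
Qed.

(* A change of exponent functions that is unitriangular for the leading
   exponent does not change the spaces of nested sums. *)
Section Triangular.
Variables (y : nat -> L) (X : nat -> nat -> L).
Hypothesis XE : forall k, (0 < k)%N -> summand (powers y) k.-1 k
  (fun d => X k d - y d ^+ k).

Lemma triangular_sub w f : nested X w f -> nested (powers y) w f.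
Proof.
elim=> {w f} [|w|w c f g _ uf _ ug|w e s f e0 s0 _ uf].
- exact: nested_one.
- exact: nested_zero.
- exact: nested_lin.
have u1 : summand (powers y) s s (fun d => X s d).
  have := summandD (summand_le (leq_pred s) (XE s0)) (summand_powers y s0).
  by move/summand_eq; apply => // d; rewrite subrK.
apply: (nested_eq (summand_sum (summand_nestedM (summand_twist e0 u1) uf))) => //.
Qed.

(** The unitriangular change is inverted by writing [y ^ s] as [X s] minus the correction
    [X s - y ^ s], with an outer induction on the weight and an inner one on the leading
    exponent. *)
Lemma triangular_sup w f : nested (powers y) w f -> nested X w f.
Proof.
elim/ltn_ind: w f => w IHw f.
have IHm m : forall w' f, (w' <= w)%N -> summand (powers y) m w' f ->
    nested X w' (fun d => \sum_(j < d) f j).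
  elim/ltn_ind: m => m IHm w' g w'w.
  move=> ug; elim: ug w'w => {w' g} [w'|w' c g g' _ IHg _ IHg'|w' e s g e0 /andP[s0 sm] ug] w'w.
  - by apply: (nested_eq (nested_zero X w')) => // d; rewrite big1.
  - apply: (nested_eq (nested_lin c (IHg w'w) (IHg' w'w))) => // d.
    by rewrite mulr_sumr -big_split.
  (* As [s] is positive, the tail [g] has weight below [w] and the outer hypothesis applies to it;
     the correction has leading exponent at most [s.-1 < m] and is left to the inner one. *)
  have w'lt : (w' < w)%N by lia.
  have u1 := nested_sum e0 s0 (IHw _ w'lt _ ug).
  have u2 := summand_nestedM (summand_twist e0 (XE s0)) ug.
  have u3 := IHm s.-1 ltac:(lia) _ _ w'w u2.
  apply: (nested_eq (nested_lin (-1) u3 u1)) => // d.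
  rewrite mulr_sumr -big_split /=; apply: eq_bigr => j _.
  by rewrite /powers; ring.
move=> uf; move: uf IHw IHm.
elim=> {w f} [|w|w c f g _ uf _ ug|w e s f e0 s0 uf _] IHw IHm.
- exact: nested_one.
- exact: nested_zero.
- by apply: nested_lin; [apply: uf | apply: ug].
- have s1 : (0 < s <= s)%N by rewrite s0 /=.
  exact: (IHm s _ _ (leqnn _) (summand_gen e0 s1 uf)).
Qed.

End Triangular.

End NestedSums.

(** * Carlitz polynomials and power sums *)

Section Carlitz.
Variables (F : finFieldType) (L : fieldType) (h : {rmorphism F -> L}).
Local Notation q := #|F|.

(** * Additivity of the powers of Frobenius *)

Lemma card_gt1 : (1 < q)%N.
Proof. exact: finNzRing_gt1. Qed.

Lemma q_gt0 : (0 < q)%N.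
Proof. exact: ltnW card_gt1. Qed.

Lemma qX_gt0 j : (0 < q ^ j)%N.
Proof. by rewrite expn_gt0 q_gt0. Qed.

Lemma pchar_nat_card j : [pchar L].-nat (q ^ j)%N.
Proof.
have [p p_pr pF] := finPcharP F; have pL := rmorph_pchar h pF.
rewrite pnatX; apply/orP; left.
have -> : q = (p ^ logn p q)%N := card_pprimeChar pF.
by rewrite pnatX pnatE // pL.
Qed.

Lemma frobD j (x y : L) : (x + y) ^+ (q ^ j) = x ^+ (q ^ j) + y ^+ (q ^ j).
Proof. exact/exprDn_pchar/pchar_nat_card. Qed.

Lemma frob0 j : (0 : L) ^+ (q ^ j) = 0.
Proof. by rewrite expr0n gtn_eqF // qX_gt0. Qed.

Lemma frobN j (x : L) : (- x) ^+ (q ^ j) = - x ^+ (q ^ j).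
Proof. by apply/eqP; rewrite -addr_eq0 -frobD addNr frob0. Qed.

Lemma frobB j (x y : L) : (x - y) ^+ (q ^ j) = x ^+ (q ^ j) - y ^+ (q ^ j).
Proof. by rewrite frobD frobN. Qed.

Lemma frob_sum j (I : Type) (r : seq I) (P : pred I) (f : I -> L) :
  (\sum_(i <- r | P i) f i) ^+ (q ^ j) = \sum_(i <- r | P i) f i ^+ (q ^ j).
Proof.
by elim/big_rec2: _ => [|i x y _ <-]; rewrite ?frob0 // frobD.
Qed.

Lemma frob_const j (c : F) : h c ^+ (q ^ j) = h c.
Proof.
rewrite -rmorphXn; congr (h _).
by elim: j => // j IH; rewrite expnS exprM expf_card IH.
Qed.

Lemma q_natr0 j : (0 < j)%N -> (q ^ j)%:R = 0 :> L.
Proof.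
case: j => // j _; have [p p_pr pF] := finPcharP F; have pL := rmorph_pchar h pF.
rewrite natrX; suff -> : q%:R = 0 :> L by rewrite expr0n.
have qE : q = (p ^ logn p q)%N := card_pprimeChar pF.
rewrite qE natrX (pcharf0 pL) expr0n.
by have := card_gt1; rewrite {1}qE; case: (logn p q).
Qed.

Variable t : L.
Hypothesis t_frob : forall i, (0 < i)%N -> t ^+ (q ^ i) != t.

Fixpoint ellL d : L := if d is d'.+1 then ellL d' * (t - t ^+ (q ^ d)) else 1.
(** The Carlitz factorial D_j, the product of the monic polynomials of degree [j] when [t] is
    theta. *)
Fixpoint DL j : L := if j is j'.+1 then (t ^+ (q ^ j) - t) * DL j' ^+ q else 1.

Lemma ellL_neq0 d : ellL d != 0.
Proof.
elim: d => [|d IH]; first exact: oner_neq0.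
by rewrite /= mulf_neq0 // subr_eq0 eq_sym t_frob.
Qed.

Definition inv_ell d := (ellL d)^-1.

Lemma inv_ellS d j : inv_ell d ^+ (q ^ j) =
  inv_ell d.+1 ^+ (q ^ j) * (t ^+ (q ^ j) - t ^+ (q ^ (d.+1 + j))).
Proof.
have n0 : t - t ^+ (q ^ d.+1) != 0 by rewrite subr_eq0 eq_sym t_frob.
rewrite /inv_ell [ellL d.+1]/= expnD exprM -frobB -exprMn; congr (_ ^+ _).
by rewrite invfM mulfVK.
Qed.

(** The extension by 0 to [d < j] makes [carlitz j d] vanish for [j > d], so that sums over [j] can
    be lengthened freely. *)
Definition shift j d : L := if (j <= d)%N then inv_ell (d - j) ^+ (q ^ j) else 0.

Lemma shiftS j d : shift j.+1 d.+1 = shift j d ^+ q.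
Proof.
rewrite /shift ltnS subSS; case: leqP => _; first by rewrite expnSr exprM.
by rewrite -[q]expn1 frob0.
Qed.

Lemma shift0 d : shift 0 d = inv_ell d.
Proof. by rewrite /shift subn0 expn0 expr1. Qed.

Definition carlitz j d : L := (DL j)^-1 * shift j d.

Lemma carlitz_gt j d : (d < j)%N -> carlitz j d = 0.
Proof. by move=> dj; rewrite /carlitz /shift leqNgt dj mulr0. Qed.

Lemma carlitz0 d : carlitz 0 d = inv_ell d.
Proof. by rewrite /carlitz shift0 invr1 mul1r. Qed.

Lemma carlitz_frob j d :
  carlitz j d ^+ q = carlitz j.+1 d.+1 * (t ^+ (q ^ j.+1) - t).
Proof.
have n0 : t ^+ (q ^ j.+1) - t != 0 by rewrite subr_eq0 t_frob.
rewrite /carlitz shiftS exprMn [DL j.+1]/= invfM exprVn mulrC [in RHS]mulrC.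
by rewrite !mulrA mulfV // mul1r mulrC.
Qed.

Lemma carlitzS j d :
  carlitz j d = carlitz j d.+1 * (t ^+ (q ^ j) - t ^+ (q ^ d.+1)).
Proof.
rewrite /carlitz /shift -mulrA; congr (_ * _).
(* At [j = d.+1] the left side vanishes by the convention in [shift] and the right side by its
   second factor. *)
case: (ltngtP j d.+1) => [jd|jd|->].
- rewrite -[(j <= d)%N]/(j < d.+1)%N jd inv_ellS -subSn // subnK //.
  exact: ltnW.
- by rewrite leqNgt (ltnW jd) mul0r.
- by rewrite subrr mulr0 ltnn.
Qed.

(** * Linearity and special values of the Carlitz polynomials *)

Definition carlitz_poly d x : L := \sum_(j < d.+1) carlitz j d * x ^+ (q ^ j).

Lemma carlitz_polyD d x y :
  carlitz_poly d (x + y) = carlitz_poly d x + carlitz_poly d y.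
Proof.
by rewrite -big_split; apply: eq_bigr => j _; rewrite frobD mulrDr.
Qed.

Lemma carlitz_polyZ d c x : carlitz_poly d (h c * x) = h c * carlitz_poly d x.
Proof.
by rewrite mulr_sumr; apply: eq_bigr => j _; rewrite exprMn frob_const mulrCA.
Qed.

Lemma carlitz_poly0 d : carlitz_poly d 0 = 0.
Proof. by rewrite /carlitz_poly big1 // => i _; rewrite frob0 mulr0. Qed.

Lemma carlitz_poly_sum d (I : Type) (r : seq I) (P : pred I) (f : I -> L) :
  carlitz_poly d (\sum_(i <- r | P i) f i) =
  \sum_(i <- r | P i) carlitz_poly d (f i).
Proof.
by elim/big_rec2: _ => [|i x y _ <-]; rewrite ?carlitz_poly0 // carlitz_polyD.
Qed.

Lemma carlitz_poly_frob d x : carlitz_poly d x ^+ q =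
  \sum_(j < d.+2) carlitz j d.+1 * (t ^+ (q ^ j) - t) * x ^+ (q ^ j).
Proof.
(* The term [j = 0] on the right vanishes because its factor is [t - t]; the remaining ones match
   the left side through [carlitz_frob]. *)
rewrite big_ord_recl /= expn0 expr1 subrr mulr0 mul0r add0r -[in LHS](expn1 q).
rewrite frob_sum; apply: eq_bigr => j _.
by rewrite !expn1 exprMn carlitz_frob -exprM -expnSr.
Qed.

Lemma carlitz_poly_mulX d x :
  carlitz_poly d.+1 (t * x) = t * carlitz_poly d.+1 x + carlitz_poly d x ^+ q.
Proof.
rewrite carlitz_poly_frob mulr_sumr -big_split; apply: eq_bigr => j _ /=.
by rewrite exprMn; ring.
Qed.

(** Coefficientwise, [carlitz_frob] contributes t^(q^j) - t and [carlitzS] contributes t^(q^j) -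
    t^(q^(d+1)); their difference no longer depends on [j]. *)
Lemma carlitz_poly_rec d x : (t ^+ (q ^ d.+1) - t) * carlitz_poly d.+1 x =
  carlitz_poly d x ^+ q - carlitz_poly d x.
Proof.
have -> : carlitz_poly d x = \sum_(j < d.+2) carlitz j d * x ^+ (q ^ j).
  by rewrite big_ord_recr /= carlitz_gt // mul0r addr0.
rewrite [X in X ^+ q]big_ord_recr /= carlitz_gt // mul0r addr0.
rewrite (carlitz_poly_frob d x) mulr_sumr -sumrB; apply: eq_bigr => j _.
by rewrite (carlitzS j d); ring.
Qed.

Lemma carlitz_poly1 d : carlitz_poly d 1 = (d == 0)%:R.
Proof.
elim: d => [|d IH].
  by rewrite /carlitz_poly big_ord1 carlitz0 expr1n mulr1 /inv_ell invr1.
have n0 : t ^+ (q ^ d.+1) - t != 0 by rewrite subr_eq0 t_frob.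
apply: (mulfI n0); rewrite carlitz_poly_rec IH mulr0.
case: (d == 0); first by rewrite expr1n subrr.
by rewrite -[q]expn1 frob0 subrr.
Qed.

(** With linearity over [F], this shows that E_d maps a polynomial of degree at most [d] to its
    coefficient of degree [d], hence is 1 on the monic ones of degree [d]. *)
Lemma carlitz_polyX d i : (i <= d)%N -> carlitz_poly d (t ^+ i) = (i == d)%:R.
Proof.
elim: i d => [|i IH] d id; first by rewrite expr0 carlitz_poly1 eq_sym.
case: d id => // d; rewrite ltnS => id.
rewrite exprS carlitz_poly_mulX !IH ?(leqW id) //.
rewrite (@ltn_eqF i) // mulr0 add0r eqSS; case: eqP => _; first exact: expr1n.
by rewrite -[q]expn1 frob0.
Qed.

Lemma sum_inv_ell m : inv_ell m ^+ q =
  (t - t ^+ q) * inv_ell m.+1 * \sum_(i < m.+1) inv_ell i ^+ q.-1.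
Proof.
have n0 m' : t - t ^+ (q ^ m'.+1) != 0 by rewrite subr_eq0 eq_sym t_frob.
have yS m' : inv_ell m' = inv_ell m'.+1 * (t - t ^+ (q ^ m'.+1)).
  by have := inv_ellS m' 0; rewrite expn0 !expr1 addn0.
have yq m' : inv_ell m' ^+ q = inv_ell m' ^+ q.-1 * inv_ell m'.
  by rewrite -exprSr prednK // q_gt0.
elim: m => [|m IH].
  rewrite big_ord1 /inv_ell /= invr1 !expr1n mulr1 mul1r expn1 mulfV //.
  by have := n0 0; rewrite expn1.
rewrite big_ord_recr /= mulrDr.
(* The factor splits as (t - t^q) + (t^q - t^(q^(m+2))). On the left, the first part gives the new
   term [i = m.+1] of the sum, and the second turns [inv_ell m.+1 ^+ q] into [inv_ell m ^+ q], the
   induction hypothesis. *)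
apply: (mulfI (n0 m.+1)).
have := inv_ellS m 1; rewrite expn1 addn1 IH => e1.
rewrite [RHS](_ : _ = (t - t ^+ q) * inv_ell m.+1 *
    (\sum_(i < m.+1) inv_ell i ^+ q.-1) + (t - t ^+ q) * inv_ell m.+1 ^+ q).
  by rewrite e1; ring.
by rewrite yq (yS m.+1); ring.
Qed.



(** * Shifted powers as combinations of summands *)

Lemma sum_ord_tail (u : nat -> L) j d : (j <= d)%N ->
  \sum_(i < d) u i = \sum_(i < d - j) u i + \sum_(i < j) u (d - i.+1)%N.
Proof.
elim: j => [|j IH] jd; first by rewrite subn0 big_ord0 addr0.
rewrite (IH (ltnW jd)) [in RHS]big_ord_recr /= addrCA [RHS]addrC.
by congr (_ + _); rewrite -(subnSK jd) big_ord_recr.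
Qed.

(** This is [sum_inv_ell] at [d - j.+1], raised to the power [q ^ j]. Its sum stops at [d - j];
    completing it to all [i < d] makes it a nested sum, and the [j] extra terms are powers of shifts
    of index at most [j]. *)
Lemma shift_rec j d : shift j.+1 d = (t - t ^+ q) ^+ (q ^ j) * (shift j d *
  (\sum_(i < d) inv_ell i ^+ (q.-1 * q ^ j) -
   \sum_(i < j) shift i.+1 d ^+ (q.-1 * q ^ (j - i.+1)))).
Proof.
case: (ltnP d j) => [dj|jd].
  by rewrite /shift leqNgt ltnS (ltnW dj) leqNgt dj !mul0r mulr0.
rewrite (sum_ord_tail (fun i => inv_ell i ^+ (q.-1 * q ^ j)) jd).
rewrite [X in _ + X - _](_ : _ =
    \sum_(i < j) shift i.+1 d ^+ (q.-1 * q ^ (j - i.+1))); last first.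
  apply: eq_bigr => i _; rewrite /shift (leq_trans (ltn_ord i) jd) -exprM.
  by congr (_ ^+ _); rewrite mulnCA -expnD subnKC.
rewrite addrK {1}/shift; case: ltnP => [jd'|dj]; last first.
  have -> : d = j by apply/eqP; rewrite eqn_leq jd dj.
  by rewrite subnn big_ord0 !mulr0.
rewrite /shift jd expnS exprM sum_inv_ell !exprMn frob_sum subnSK // -mulrA.
by congr (_ * (_ * _)); apply: eq_bigr => i _; rewrite -exprM.
Qed.

(** Strong induction through [shift_rec]. For [j > 0] the leading exponent drops from the weight
    [q ^ j] to at most [q ^ j.-1]; at [j = 0] the bound is the weight 1 itself. *)
Lemma summand_shift j :
  summand h (powers inv_ell) (q ^ j.-1) (q ^ j) (shift j).
Proof.
elim/ltn_ind: j => -[_|j IH].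
  have := summand_powers h inv_ell (ltnSn 0); move/summand_eq; apply=> // d.
  by rewrite shift0.
have q1 : (0 < q.-1)%N by have := card_gt1; lia.
have e0 i : (0 < q.-1 * q ^ i)%N by rewrite muln_gt0 q1 qX_gt0.
have E i : (i < j)%N -> (q ^ i.+1 * (q.-1 * q ^ (j - i.+1)) = q.-1 * q ^ j)%N.
  by move=> ij; rewrite mulnCA -expnD subnKC.
have u1 := summand_sum (summand_powers h inv_ell (e0 j)).
have u2 := summand_nestedM (IH j (ltnSn j)) u1.
have wE : (q ^ j + q.-1 * q ^ j = q ^ j.+1)%N.
  by rewrite -mulSn prednK ?expnS // q_gt0.
rewrite wE in u2.
have mj : (q ^ j.-1 <= q ^ j)%N by rewrite leq_exp2l ?leq_pred // card_gt1.
(* The leading exponents add up to q^(j-1) + q^i (q - 1) q^(j-i-1) = q^j, exactly the bound wanted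
   at [j.+1]. *)
have u3 (i : 'I_j) : summand h (powers inv_ell) (q ^ j) (q ^ j.+1)
    (fun d => shift j d * shift i.+1 d ^+ (q.-1 * q ^ (j - i.+1))).
  have ij := ltn_ord i.
  have := summandM (IH j (ltnSn j)) (summandX (e0 (j - i.+1)%N) (IH i.+1 ij)).
  rewrite E // wE; apply: summand_le; rewrite /= mulnCA -expnD.
  have -> : (i + (j - i.+1) = j.-1)%N by lia.
  by rewrite -mulSn prednK ?q_gt0 // -expnS prednK //; lia.
have u4 := summand_bigsum (index_enum 'I_j) (P := predT) (fun i _ => u3 i).
have := summandD (summandZ ((t - t ^+ q) ^+ (q ^ j)) (summand_le mj u2))
                 (summandZ (- (t - t ^+ q) ^+ (q ^ j)) (u4)).
move/summand_eq; apply=> // d.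
rewrite shift_rec mulrBr mulrBr mulNr; congr (_ * _ - _ * _).
by rewrite mulr_sumr.
Qed.

(** * Leading terms of solutions of the power sum recursion *)

Section PowerSums.
Variable S : nat -> nat -> L.
Hypothesis S1 : forall d, S 1 d = inv_ell d.
Hypothesis S_rec : forall k d, (0 < k)%N -> S k.+1 d =
  \sum_(j < k.+1 | (q ^ j <= k)%N) carlitz j d * S (k.+1 - q ^ j) d.

(** The term [j = 0] of the recursion multiplies the preceding case by [inv_ell d] and produces the
    main term; in every other term [summand_shift] forces a strictly smaller leading exponent. *)
Lemma power_sum_leading k : (0 < k)%N ->
  summand h (powers inv_ell) k.-1 k (fun d => S k d - inv_ell d ^+ k).
Proof.
elim/ltn_ind: k => -[//|[|k]] IH _.
  apply: (summand_eq (summand_zero h (powers inv_ell) 0 1) erefl) => d.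
  by rewrite S1 expr1 subrr.
have u1 := summandM (summand_powers h inv_ell (ltnSn 0)) (IH k.+1 (ltnSn _) isT).
have u2 (j : 'I_k.+1) : (q ^ j.+1 <= k.+1)%N ->
    summand h (powers inv_ell) k.+1 k.+2
      (fun d => carlitz j.+1 d * S (k.+2 - q ^ j.+1) d).
  move=> jk; have qj := qX_gt0 j.+1.
  have u0 : (0 < k.+2 - q ^ j.+1)%N by rewrite subn_gt0.
  have u1' : (k.+2 - q ^ j.+1 < k.+2)%N by rewrite ltn_subrL qj.
  have u := summandD (summand_le (leq_pred _) (IH _ u1' u0))
              (summand_powers h inv_ell u0).
  have lt : (q ^ j < q ^ j.+1)%N by rewrite ltn_exp2l // card_gt1.
  (* The coefficient of index [j.+1] has weight [q ^ j.+1] but leading exponent at most [q ^ j],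
     which saves at least one. *)
  have b1 : (q ^ j.+1.-1 + (k.+2 - q ^ j.+1) <= k.+1)%N.
    by rewrite /=; move: (q ^ j)%N (q ^ j.+1)%N lt jk => a b; lia.
  have := summandZ (DL j.+1)^-1 (summand_le b1 (summandM (summand_shift j.+1) u)).
  move/summand_eq; apply=> [|d]; first by rewrite subnKC // ltnW.
  by rewrite subrK mulrA.
have u3 := summand_bigsum (index_enum 'I_k.+1) u2.
have := summandD u1 u3; move/summand_eq; apply=> // d.
rewrite (S_rec d (ltn0Sn k)) [in RHS]big_mkcond big_ord_recl /= expn0 subSS subn0.
by rewrite carlitz0 -big_mkcond [in RHS]exprS expr1; ring.
Qed.

End PowerSums.

(* [1 - carlitz_poly d] vanishes at [q ^ d] points and has constant derivative,
   so its logarithmic derivative is the generating series of the power sums. *)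
Section Interpolation.
Variables (d : nat) (rs : seq L).
Hypothesis rs_uniq : uniq rs.
Hypothesis rs_size : size rs = (q ^ d)%N.
Hypothesis rs1 : forall a, a \in rs -> carlitz_poly d a = 1.

Let P : {poly L} := 1 - \sum_(j < d.+1) carlitz j d *: 'X^(q ^ j).

Let P_horner x : P.[x] = 1 - carlitz_poly d x.
Proof.
rewrite /P !hornerE horner_sum; congr (_ - _).
by apply: eq_bigr => j _; rewrite !hornerE.
Qed.

Let P_size : (size P <= (q ^ d).+1)%N.
Proof.
rewrite (leq_trans (size_polyD _ _)) // geq_max size_poly1 size_polyN /=.
rewrite (leq_trans (size_sum _ _ _)) //; apply/bigmax_leqP => j _.
rewrite (leq_trans (size_scale_leq _ _)) // size_polyXn ltnS.
by rewrite leq_exp2l ?card_gt1 // -ltnS.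
Qed.

Let P_deriv : P^`() = (- inv_ell d)%:P.
Proof.
have d1 : (1 : {poly L})^`() = 0 by exact: derivC.
rewrite /P derivB d1 sub0r (raddf_sum (@deriv L)) big_ord_recl /= big1 => [|j _].
  by rewrite addr0 expn0 derivZ derivX carlitz0 polyCN alg_polyC.
by rewrite derivZ derivXn -mulr_natr -polyC_natr q_natr0 // mulr0 scaler0.
Qed.

Let quo a := P %/ ('X - a%:P).

Let quoE a : a \in rs -> P = quo a * ('X - a%:P).
Proof.
by move=> ars; rewrite divpK // dvdp_XsubCl rootE P_horner rs1 // subrr.
Qed.

Lemma rs_neq0 a : a \in rs -> a != 0.
Proof.
move=> /rs1; apply: contra_eqN => /eqP ->.
by rewrite carlitz_poly0 eq_sym oner_eq0.
Qed.

(** Both sides have size at most [q ^ d] and agree at the [q ^ d] points [b] of [rs]: the product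
    rule gives P'(b) as the value of [quo b] at [b], and the other quotients vanish there. *)
Let sum_quo : \sum_(a <- rs) quo a = (- inv_ell d)%:P.
Proof.
apply/eqP; rewrite -subr_eq0; apply: contraT => R0.
set R := (X in X != 0) in R0.
have Rroot : all (root R) rs.
  apply/allP => b brs; rewrite rootE /R hornerD hornerN hornerC horner_sum.
  rewrite (bigD1_seq b) //= big1_seq ?addr0 => [|a /andP[ab ars]].
    rewrite -(hornerC (- inv_ell d) b) -P_deriv.
    by rewrite [in P^`()](quoE brs) derivM derivXsubC !hornerE subrr; apply/eqP; ring.
  have /eqP : P.[b] = 0 by rewrite P_horner rs1 // subrr.
  rewrite (quoE ars) hornerM hornerXsubC mulf_eq0 => /orP[/eqP //|].
  by rewrite subr_eq0 => /eqP ba; rewrite ba eqxx in ab.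
have := max_poly_roots R0 Rroot rs_uniq; rewrite rs_size ltnNge => /negP[].
have qd : (0 < q ^ d)%N := qX_gt0 d.
rewrite (leq_trans (size_polyD _ _)) // geq_max size_polyN; apply/andP; split.
  rewrite (leq_trans (size_sum _ _ _)) //; apply/bigmax_leqP_seq => a ars _.
  by rewrite size_divp ?polyXsubC_eq0 // size_XsubC /= leq_subLR add1n.
by rewrite (leq_trans (size_polyC_leq1 _)).
Qed.

Lemma power_sum_conv k : \sum_(a <- rs) a ^- k.+1 =
  \sum_(j < d.+1 | (q ^ j <= k)%N)
     carlitz j d * (\sum_(a <- rs) a ^- (k.+1 - q ^ j))
  + (k == 0)%:R * inv_ell d.
Proof.
(* [G] truncates the sum of the series 1 / (a - X). Hence [P * G] is -P', that is [inv_ell d],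
   modulo X^(k+1), and the claim is the coefficient of X^k. *)
pose G : {poly L} := \poly_(i < k.+1) \sum_(a <- rs) a ^- i.+1.
have GE : G = \sum_(a <- rs) \poly_(i < k.+1) a ^- i.+1.
  apply/polyP => i; rewrite coef_sum coef_poly; case: ltnP => ik.
    by apply: eq_bigr => a _; rewrite coef_poly ik.
  by rewrite big1 // => a _; rewrite coef_poly ltnNge ik.
have tele (a : L) : a != 0 -> ('X - a%:P) * (\poly_(i < k.+1) a ^- i.+1) =
    a ^- k.+1 *: 'X^(k.+1) - 1.
  move=> a0; apply/polyP => i; rewrite mulrBl !coefB coefXM coefCM coefZ coefXn.
  rewrite coef1 !coef_poly; case: i => [|i] /=.
    by rewrite expr1 mulfV // mulr0.
  rewrite !ltnS eqSS.
  have ai : a * a ^- i.+2 = a ^- i.+1.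
    by rewrite [in LHS]exprS invfM mulrA mulfV // mul1r.
  case: (ltngtP i k) => ik; rewrite ?mulr0 ?mulr1 ?subr0 //.
  - by rewrite ai subrr.
  - by rewrite ik.
have PG : P * G = 'X^(k.+1) * (\sum_(a <- rs) a ^- k.+1 *: quo a) + (inv_ell d)%:P.
  rewrite -[in RHS](opprK (inv_ell d)) polyCN -sum_quo GE !mulr_sumr -sumrB.
  apply: eq_big_seq => a ars; rewrite (quoE ars) -mulrA tele ?rs_neq0 //.
  by rewrite mulrBr mulr1 -!scalerAr [in RHS]mulrC.
have := congr1 (fun p : {poly L} => p`_k) PG.
rewrite coefD coefXnM ltnSn add0r coefC /P mulrBl mul1r coefB coef_poly ltnSn.
rewrite mulr_suml coef_sum => /eqP; rewrite subr_eq => /eqP ->; rewrite addrC.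
congr (_ + _); last by case: (k == 0)%N; rewrite ?mul1r ?mul0r.
rewrite [RHS]big_mkcond; apply: eq_bigr => j _.
rewrite -scalerAl coefZ coefXnM ltnNge; case: leqP => jk; rewrite ?mulr0 //=.
by rewrite coef_poly ltnS leq_subr subSn.
Qed.

End Interpolation.

Lemma nested_power_sums (rs : nat -> seq L) w (f : nat -> L) :
  (forall d, uniq (rs d)) -> (forall d, size (rs d) = (q ^ d)%N) ->
  (forall d a, a \in rs d -> carlitz_poly d a = 1) ->
  nested h (fun s d => \sum_(a <- rs d) a ^- s) w f <->
  nested h (powers inv_ell) w f.
Proof.
move=> rsU rsN rs1; set S := fun _ _ => _.
have conv k d := power_sum_conv (rsU d) (rsN d) (rs1 d) k.
have S1 d : S 1%N d = inv_ell d.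
  rewrite /S conv big_pred0 ?mul1r ?add0r // => j.
  by rewrite leqNgt qX_gt0.
have S_rec k d : (0 < k)%N -> S k.+1 d =
    \sum_(j < k.+1 | (q ^ j <= k)%N) carlitz j d * S (k.+1 - q ^ j)%N d.
  move=> k0; rewrite /S conv gtn_eqF // mul0r addr0.
  (* The ranges [j <= d] and [j <= k] are compared inside a common larger one: [carlitz j d]
     vanishes for [j > d], and [q ^ j <= k] forces [j <= k]. *)
  have le1 : (d.+1 <= d.+1 + k.+1)%N by lia.
  have le2 : (k.+1 <= d.+1 + k.+1)%N by lia.
  rewrite (big_ord_widen_cond _ (fun j => (q ^ j <= k)%N)
    (fun j => carlitz j d * \sum_(a <- rs d) a ^- (k.+1 - q ^ j)) le1).
  rewrite (big_ord_widen_cond _ (fun j => (q ^ j <= k)%N)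
    (fun j => carlitz j d * \sum_(a <- rs d) a ^- (k.+1 - q ^ j)) le2).
  rewrite big_mkcond [RHS]big_mkcond; apply: eq_bigr => j _.
  case: (leqP (q ^ j) k) => //= qjk.
  rewrite !ltnS (leq_trans (ltnW (ltn_expl j card_gt1)) qjk).
  by case: leqP => // dj; rewrite carlitz_gt // mul0r.
have XE := power_sum_leading S1 S_rec.
by split; [apply: triangular_sub | apply: triangular_sup].
Qed.

End Carlitz.

(** * Convergence in K_oo *)

Section Valuation.
Variable F : fieldType.
Implicit Types (u v w : fps F) (x y z : Kinf F) (p : {poly F}).

(** Valuation at infinity at least [N]; [Kinf_ball N x y] unfolds to [val_ge N (y - x)]. *)
Definition val_ge N z := exists u : fps F, z = fpsK (fpsX F ^+ N * u).

Lemma val_ge0 N : val_ge N 0.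
Proof. by exists 0; rewrite mulr0 rmorph0. Qed.

Lemma val_geD N y z : val_ge N y -> val_ge N z -> val_ge N (y + z).
Proof. by move=> [u ->] [v ->]; exists (u + v); rewrite mulrDr rmorphD. Qed.

Lemma val_geN N z : val_ge N z -> val_ge N (- z).
Proof. by move=> [u ->]; exists (- u); rewrite mulrN rmorphN. Qed.

Lemma val_geM M N y z : val_ge M y -> val_ge N z -> val_ge (M + N) (y * z).
Proof.
move=> [u ->] [v ->]; exists (u * v).
by rewrite -rmorphM exprD; congr (fpsK _); ring.
Qed.

Lemma val_ge_le M N z : (M <= N)%N -> val_ge N z -> val_ge M z.
Proof.
move=> MN [u ->]; exists (fpsX F ^+ (N - M) * u).
by rewrite mulrA -exprD subnKC.
Qed.

Lemma val_ge_fps u : val_ge 0 (fpsK u).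
Proof. by exists u; rewrite mul1r. Qed.

Lemma val_ge_sum N (I : Type) (r : seq I) (P : pred I) (f : I -> Kinf F) :
  (forall i, P i -> val_ge N (f i)) -> val_ge N (\sum_(i <- r | P i) f i).
Proof.
move=> fN; elim/big_rec: _ => [|i y Pi]; first exact: val_ge0.
exact/val_geD/fN.
Qed.

Lemma val_geX N s z : (0 < s)%N -> val_ge N z -> val_ge N (z ^+ s).
Proof.
case: s => // s _ Nz; rewrite exprS; apply: (@val_ge_le _ (N + 0)).
  by rewrite addn0.
apply: val_geM => //; elim: s => [|s IH].
  by rewrite expr0 -(rmorph1 (@fpsK F)); exact: val_ge_fps.
by rewrite exprS -[0%N]addn0; apply: val_geM => //; exact: (val_ge_le (leq0n N)).
Qed.

Lemma fps_dvdXn N w : (forall n, (n < N)%N -> coefs w n = 0) ->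
  exists v, w = fpsX F ^+ N * v.
Proof.
move=> w0; exists (Fps (fun n => coefs w (n + N))); apply/fpsP => n.
by rewrite coefsXnM; case: ltnP => [/w0 //|Nn] /=; rewrite subnK.
Qed.

Lemma fps_invertible u : coefs u 0 != 0 -> exists v, u * v = 1.
Proof.
move=> u0; pose w := 1 - fpsC (coefs u 0)^-1 * u.
have [w' wE] : exists w', w = fpsX F ^+ 1 * w'.
  apply: fps_dvdXn => -[|//] _.
  by rewrite coefsB coefs1 coefsCM mulVf // subrr.
have wX m n : (n < m)%N -> coefs (w ^+ m) n = 0.
  by move=> nm; rewrite wE expr1 exprMn coefsXnM nm.
(* Geometric series for the inverse of [1 - w]: [w ^+ m] has no coefficient below degree [m], so the
   one of degree [n] is settled after [n.+1] terms. *)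
pose v := Fps (fun n => coefs (\sum_(i < n.+1) w ^+ i) n).
have vE n m : (m <= n)%N -> coefs v m = coefs (\sum_(i < n.+1) w ^+ i) m.
  move=> mn; rewrite -(subnKC mn) -addSn big_split_ord coefsD.
  rewrite [X in _ + X]coefs_sum [X in _ + X]big1 ?addr0 // => i _.
  by rewrite wX // ltnS leq_addr.
exists (fpsC (coefs u 0)^-1 * v); rewrite mulrCA mulrA.
have -> : fpsC (coefs u 0)^-1 * u = 1 - w by rewrite /w subKr.
apply/fpsP => n; rewrite mulrC coefsM.
transitivity (coefs ((\sum_(i < n.+1) w ^+ i) * (1 - w)) n).
  by rewrite coefsM; apply: eq_bigr => i _; rewrite -vE // -ltnS.
have -> : (\sum_(i < n.+1) w ^+ i) * (1 - w) = 1 - w ^+ n.+1.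
  rewrite -[X in X - w ^+ _](expr1n _ n.+1) subrXX mulrC; congr (_ * _).
  by apply: eq_bigr => i _; rewrite expr1n mul1r.
by rewrite coefsB wX // subr0.
Qed.

Lemma fpsKX_neq0 n : fpsK (fpsX F) ^+ n != 0.
Proof. by rewrite expf_neq0 // tofrac_eq0 fpsX_neq0. Qed.

(** Multiplying by the [n]-th power of 1/theta reverses the coefficients of [p]. When [n] is the
    degree of [p], the constant term is the leading coefficient and the series is a unit. *)
Lemma AtoKinf_fps p n : (size p <= n.+1)%N ->
  exists2 u, fpsK u = AtoKinf p * fpsK (fpsX F) ^+ n & coefs u 0 = p`_n.
Proof.
elim/poly_ind: p n => [|p c IH] n sp.
  by exists 0; rewrite ?rmorph0 ?mul0r // coef0.
have cE : AtoKinf c%:P = fpsK (fpsC c).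
  by rewrite /AtoKinf map_polyC hornerC.
have thX : theta F * fpsK (fpsX F) = 1.
  by rewrite mulVf //; have := fpsKX_neq0 1; rewrite expr1.
have XE : AtoKinf 'X = theta F by rewrite /AtoKinf map_polyX hornerX.
case: n sp => [|n] sp.
  exists (fpsC c); rewrite ?coefD ?coefC ?coefMX ?add0r //.
  have p0 : p = 0.
    apply/eqP; rewrite -size_poly_eq0; apply: contraLR sp => p0.
    rewrite size_MXaddC -ltnNge; case: ifP => [/andP[/eqP p0']|_].
      by rewrite p0' size_poly0 in p0.
    by rewrite ltnS lt0n.
  by rewrite p0 mul0r add0r cE mulr1.
have [u uE u0] : exists2 u, fpsK u = AtoKinf p * fpsK (fpsX F) ^+ n
    & coefs u 0 = p`_n.
  apply: IH; move: sp; rewrite size_MXaddC; case: ifP => [/andP[/eqP-> _] _|_ //].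
  by rewrite size_poly0.
exists (u + fpsC c * fpsX F ^+ n.+1).
  rewrite rmorphD rmorphM rmorphXn /= uE rmorphD rmorphM /= XE cE mulrDl.
  congr (_ + _).
  by rewrite exprS -[in RHS]mulrA [theta F * _]mulrA thX mul1r.
by rewrite coefsD u0 coefsCM coefsXn mulr0 addr0 coefD coefC addr0 coefMX.
Qed.

Lemma val_ge_AtoKinfM p N m z : (size p <= m.+1)%N ->
  val_ge (N + m) z -> val_ge N (AtoKinf p * z).
Proof.
move=> /AtoKinf_fps[u uE _] [v ->]; exists (u * v).
by rewrite exprD mulrCA !rmorphM !rmorphXn /= uE; ring.
Qed.

Lemma val_ge_AtoKinfV p : p != 0 -> val_ge (size p).-1 (AtoKinf p)^-1.
Proof.
move=> p0; have sp : (size p <= (size p).-1.+1)%N by rewrite leqSpred.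
have [u uE u0] := AtoKinf_fps sp; have := lead_coef_eq0 p.
rewrite lead_coefE -u0 (negbTE p0) => /negbT /fps_invertible [v uv].
have fv0 : fpsK u * fpsK v = 1 by rewrite -rmorphM uv rmorph1.
exists v; rewrite rmorphM rmorphXn.
have p0' : AtoKinf p != 0 by rewrite AtoKinf_eq0.
by apply: (mulfI p0'); rewrite mulfV // mulrA -uE fv0.
Qed.

(** A fixed power of 1/theta clears the pole of [c], so scaling loses a bounded amount of valuation;
    this continuity gives [converges_lin]. *)
Lemma val_ge_KtoKinfM (c : K F) : exists m, forall N z,
  val_ge (N + m) z -> val_ge N (KtoKinf c * z).
Proof.
have [p [r [r0 ->]]] := fracP c; exists (size p).-1 => N z Nz.
rewrite -[FracField.tofrac p]/(toK p) -[FracField.tofrac r]/(toK r).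
rewrite fmorph_div /= !KtoKinf_toK mulrAC -mulrA.
apply: (@val_ge_AtoKinfM _ _ (size p).-1); first by rewrite leqSpred.
apply: (@val_ge_le _ (N + (size p).-1 + (size r).-1)); first by rewrite leq_addr.
by apply: val_geM => //; exact: val_ge_AtoKinfV.
Qed.

Definition converges (f : nat -> K F) z :=
  forall N, exists M, forall n, (M <= n)%N -> val_ge N (z - KtoKinf (f n)).

Lemma converges_unique f y z : converges f y -> converges f z -> y = z.
Proof.
move=> fy fz; apply: Kinf_ball_eq => N.
have [M yM] := fy N; have [M' zM] := fz N.
have := val_geD (zM _ (leq_maxr M M')) (val_geN (yM _ (leq_maxl M M'))).
by rewrite opprB addrA subrK.
Qed.

Lemma converges0 : converges (fun=> 0) 0.
Proof. by move=> N; exists 0%N => n _; rewrite rmorph0 subrr; exact: val_ge0. Qed.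

Lemma converges_lin c f g y z : converges f y -> converges g z ->
  converges (fun d => c * f d + g d) (KtoKinf c * y + z).
Proof.
move=> fy gz N; have [m cm] := val_ge_KtoKinfM c.
have [M yM] := fy (N + m)%N; have [M' zM] := gz N.
exists (maxn M M') => n; rewrite geq_max => /andP[/yM yn /zM zn].
have := val_geD (cm _ _ yn) zn; congr (val_ge N _).
by rewrite rmorphD rmorphM; ring.
Qed.

(** Up to the first term of the sequence, everything happens among power series: the steps are
    divisible by growing powers of [fpsX], so the coefficient of degree [n] is constant from
    [S n.+1] on. *)
Lemma Kinf_complete (a : nat -> Kinf F) :
  (forall N, val_ge N (a N.+1 - a N)) ->
  exists z, forall N, val_ge N (z - a N).
Proof.
move=> /choice[u uE].
pose S N := \sum_(i < N) fpsX F ^+ i * u i.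
have aE N : a N = a 0%N + fpsK (S N).
  elim: N => [|N IH]; first by rewrite /S big_ord0 rmorph0 addr0.
  by rewrite /S big_ord_recr rmorphD /= -uE addrA -IH addrC subrK.
exists (a 0%N + fpsK (Fps (fun n => coefs (S n.+1) n))) => N.
rewrite (aE N) opprD addrACA subrr add0r -rmorphB.
set w := _ - _; have [v ->] : exists v, w = fpsX F ^+ N * v; last by exists v.
apply: fps_dvdXn => n nN; rewrite coefsB /=; apply/eqP; rewrite subr_eq0; apply/eqP.
rewrite /S -(subnKC nN) big_split_ord coefsD.
rewrite [X in _ + X]coefs_sum [X in _ + X]big1 ?addr0 // => i _.
by rewrite coefsXnM ltnS leq_addr.
Qed.

End Valuation.

(** * Partial sums over chains of indices *)

Section LinearSpan.
Variables (R : pzRingType) (V : lmodType R).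
Implicit Types (S : set V) (x y v : V) (c : R).

Lemma linear_span0 S : linear_span S 0.
Proof.
exists 0%N, (fun=> 0), (fun=> 0); split; first by case.
by rewrite big_ord0.
Qed.

Lemma linear_span_cons S c x v :
  S x -> linear_span S v -> linear_span S (c *: x + v).
Proof.
move=> Sx [m [d [y [Sy ->]]]].
exists m.+1, (fun i => if unlift ord0 i is Some j then d j else c),
  (fun i => if unlift ord0 i is Some j then y j else x); split.
  by move=> i; case: unliftP.
rewrite big_ord_recl unlift_none; congr (_ + _).
by apply: eq_bigr => i _; rewrite liftK.
Qed.

Lemma linear_span_lin S c y v :
  linear_span S y -> linear_span S v -> linear_span S (c *: y + v).
Proof.
move=> [m [d [x [Sx ->]]]]; elim: m d x Sx => [|m IH] d x Sx Sv.
  by rewrite big_ord0 scaler0 add0r.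
rewrite big_ord_recl scalerDr scalerA -addrA.
by apply: linear_span_cons => //; apply: IH.
Qed.

Lemma linear_span_sub S S' : (forall x, S x -> linear_span S' x) ->
  forall v, linear_span S v -> linear_span S' v.
Proof.
move=> SS' _ [m [d [x [Sx ->]]]]; elim: m d x Sx => [|m IH] d x Sx.
  by rewrite big_ord0; exact: linear_span0.
rewrite big_ord_recl; apply: linear_span_lin; first exact: SS'.
exact: IH.
Qed.

End LinearSpan.

(** * Truncated values and their spans *)

Section Words.
Variables (F : finFieldType) (L : fieldType) (h : {rmorphism F -> L}).
Variable X : nat -> nat -> L.

Fixpoint word_sum n : ('I_n -> F) -> ('I_n -> nat) -> nat -> L :=
  match n with
  | 0 => fun _ _ _ => 1
  | n'.+1 => fun eps s d => \sum_(j < d) h (eps ord0 ^+ j) * X (s ord0) j *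
      word_sum (fun i => eps (lift ord0 i)) (fun i => s (lift ord0 i)) j
  end.

Lemma admissible_nested w n (eps : 'I_n -> F) (s : 'I_n -> nat) :
  admissible w eps s -> nested h X w (word_sum eps s).
Proof.
elim: n w eps s => [|n IH] w eps s [eps0 s0 <-].
  by rewrite big_ord0; exact: nested_one.
by rewrite big_ord_recl /=; apply: nested_sum => //; apply: IH.
Qed.

Inductive word_span w : (nat -> L) -> Prop :=
| word_span0 : word_span w (fun=> 0)
| word_span_cons c n (eps : 'I_n -> F) (s : 'I_n -> nat) f :
    admissible w eps s -> word_span w f ->
    word_span w (fun d => c * word_sum eps s d + f d).

Lemma word_span_lin w c f g : word_span w f -> word_span w g ->
  word_span w (fun d => c * f d + g d).
Proof.
move=> uf ug; elim: uf => {f} [|c' n eps s f adm _ IH].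
  by rewrite (_ : (fun d => _) = g) //; apply/funext => d; rewrite mulr0 add0r.
have := word_span_cons (c * c') adm IH.
by congr (word_span w _); apply/funext => d; ring.
Qed.

Lemma word_span_sum w e k f : e != 0 -> (0 < k)%N -> word_span w f ->
  word_span (k + w) (fun d => \sum_(j < d) h (e ^+ j) * X k j * f j).
Proof.
move=> e0 k0; elim=> {f} [|c n eps s f [eps0 s0 sw] _ IH].
  rewrite (_ : (fun d => _) = (fun=> 0)); first exact: word_span0.
  by apply/funext => d; rewrite big1 // => j _; rewrite mulr0.
pose eps' i := if unlift ord0 i is Some j then eps j else e.
pose s' i := if unlift ord0 i is Some j then s j else k.
have adm : admissible (k + w) eps' s'.
  split=> [i|i|]; [by rewrite /eps'; case: unliftP | by rewrite /s'; case: unliftP |].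
  rewrite big_ord_recl /s' unlift_none -sw; congr (_ + _)%N.
  by apply: eq_bigr => i _; rewrite liftK.
have := word_span_cons c adm IH; congr (word_span _ _); apply/funext => d /=.
rewrite mulr_sumr -big_split /=; apply: eq_bigr => j _.
rewrite /eps' /s' unlift_none.
rewrite (_ : (fun i : 'I_n => _) = eps); last by apply/funext => i; rewrite liftK.
rewrite (_ : (fun i : 'I_n => _) = s); last by apply/funext => i; rewrite liftK.
ring.
Qed.

(** Linear combinations occurring inside nested sums are pulled out by linearity, leaving a
    combination of truncated values with admissible data. *)
Lemma nested_word_span w f : nested h X w f -> word_span w f.
Proof.
elim=> {w f} [|w|w c f g _ uf _ ug|w e k f e0 k0 _ uf].
- have adm : admissible 0 (fun _ : 'I_0 => 1 : F) (fun=> 0%N).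
    by split; [case|case|rewrite big_ord0].
  have := word_span_cons 1 adm (word_span0 _).
  by congr (word_span _ _); apply/funext => d /=; rewrite mul1r addr0.
- exact: word_span0.
- exact: word_span_lin.
- exact: word_span_sum.
Qed.

End Words.

Section Sums.
Variable F : finFieldType.
Local Notation toKC := (@toK F \o @polyC F).

(** A finite set containing [e N] adds to its sum only terms of valuation at least [N], so by the
    ultrametric inequality its partial sum stays in the ball of index [N] around [z]. *)
Lemma Kinf_sum_exhaustion (I : choiceType) (x : I -> Kinf F) (e : nat -> seq I)
    (z : Kinf F) :
  (forall N, uniq (e N)) ->
  (forall N i, i \notin e N -> val_ge N (x i)) ->
  (forall N, val_ge N (z - \sum_(i <- e N) x i)) ->
  Kinf_sum x = z.
Proof.
move=> eU xN zN; have PF := @summability.totally_filter I.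
apply: cvg_lim; first exact: Kinf_hausdorff.
move=> A [N _ NA]; exists [fset i in e N]%fset => // B eB.
apply: NA; rewrite /= /summability.partial_sum.
rewrite -(big_seq_fsetE _ _ predT x) -[Kinf_ball _ _ _]/(val_ge N (_ - z)).
rewrite (big_fsetID _ (mem (e N))) /=.
have -> : [fset i in B | i \in e N]%fset = [fset i in e N]%fset.
  apply/fsetP => i; rewrite !inE /=; case: (boolP (i \in e N)); rewrite ?andbF // andbT.
  by move=> ie; move/fsubsetP: eB; apply; rewrite !inE.
have -> : \sum_(i <- [fset i in e N]%fset) x i = \sum_(i <- e N) x i.
  by apply: perm_big; apply: uniq_perm => // i; rewrite !inE.
rewrite addrAC -opprB; apply: (val_geD (val_geN (zN N))).
rewrite big_seq_cond; apply: val_ge_sum => i; rewrite andbT !inE /= => /andP[_].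
exact: xN.
Qed.

(** Common frame for both kinds of values: for AMZVs, [T] consists of polynomials, [good] means
    monic, [D] is the degree and [den] the identity; for ACMPLs, [T] is [nat], [D] the identity and
    [den] is [ell]. *)
Variables (T : choiceType) (D : T -> nat) (good : pred T) (level : nat -> seq T).
Variable den : T -> {poly F}.
Hypothesis level_uniq : forall d, uniq (level d).
Hypothesis mem_level : forall d x, (x \in level d) = good x && (D x == d).
Hypothesis den_neq0 : forall x, good x -> den x != 0.
Hypothesis den_deg : forall x, good x -> (D x <= (size (den x)).-1)%N.

Definition level_sum s d : K F := \sum_(x <- level d) toK (den x) ^- s.

Definition term n (eps : 'I_n -> F) (s : 'I_n -> nat) (a : {ffun 'I_n -> T}) :=
  \prod_(i < n) (toK (eps i ^+ D (a i))%:P / toK (den (a i)) ^+ s i) : K F.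

Fixpoint below N := if N is N'.+1 then below N' ++ level N' else [::].

Lemma mem_below N x : (x \in below N) = good x && (D x < N)%N.
Proof.
elim: N => [|N IH]; first by rewrite ltn0 andbF.
by rewrite mem_cat IH mem_level -andb_orr orbC [in RHS]ltnS -leq_eqVlt.
Qed.

Lemma below_uniq N : uniq (below N).
Proof.
elim: N => //= N IH; rewrite cat_uniq IH level_uniq andbT.
apply/hasPn => x; rewrite mem_level mem_below => /andP[_ /eqP ->].
by rewrite ltnn andbF.
Qed.

Lemma sum_below (f : T -> K F) N :
  \sum_(x <- below N) f x = \sum_(j < N) \sum_(x <- level j) f x.
Proof.
elim: N => [|N IH]; first by rewrite big_nil big_ord0.
by rewrite big_cat big_ord_recr /= IH.
Qed.

Definition ffun_cons n x (a : {ffun 'I_n -> T}) : {ffun 'I_n.+1 -> T} :=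
  [ffun i => if unlift ord0 i is Some k then a k else x].

Lemma ffun_cons0 n x (a : {ffun 'I_n -> T}) : ffun_cons x a ord0 = x.
Proof. by rewrite ffunE unlift_none. Qed.

Lemma ffun_consS n x (a : {ffun 'I_n -> T}) i :
  ffun_cons x a (lift ord0 i) = a i.
Proof. by rewrite ffunE liftK. Qed.

(** The head, at index 0, has the largest level, and this level is the strict bound for the tail. *)
Fixpoint chains n : nat -> seq {ffun 'I_n -> T} :=
  match n with
  | 0 => fun N => [:: ffun0 (card_ord 0)]
  | n'.+1 => fun N =>
      [seq ffun_cons x a | x <- below N, a <- chains n' (D x)]
  end.

Lemma chains_uniq n N : uniq (chains n N).
Proof.
elim: n N => //= n IH N; apply: allpairs_uniq_dep.
- exact: below_uniq.
- by move=> x _; exact: IH.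
move=> [x a] [y b] _ _ /= xayb.
have xy : x = y by rewrite -(ffun_cons0 x a) xayb ffun_cons0.
rewrite -xy in xayb *; congr (Tagged _ _).
by apply/ffunP => i; rewrite -(ffun_consS x a) xayb ffun_consS.
Qed.

Definition chain_pred n (a : {ffun 'I_n -> T}) : bool :=
  [forall i, good (a i)] &&
  [forall i : 'I_n, forall j : 'I_n, (i < j)%N ==> (D (a j) < D (a i))%N].

Lemma chain_predP n (a : {ffun 'I_n -> T}) :
  reflect ((forall i, good (a i)) /\
           (forall i j : 'I_n, (i < j)%N -> (D (a j) < D (a i))%N))
          (chain_pred a).
Proof.
apply: (iffP andP) => -[ga da]; split.
- exact/forallP.
- by move=> i j ij; move/forallP/(_ i)/forallP/(_ j)/implyP: da; apply.
- exact/forallP.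
- by apply/forallP => i; apply/forallP => j; apply/implyP; exact: da.
Qed.

Lemma mem_chains n N (a : {ffun 'I_n -> T}) :
  (a \in chains n N) = chain_pred a && [forall i, (D (a i) < N)%N].
Proof.
elim: n N a => [|n IH] N a /=.
  have -> : a = ffun0 (card_ord 0) by apply/ffunP => -[].
  rewrite mem_seq1 eqxx; symmetry; apply/andP; split; last by apply/forallP => -[].
  by apply/chain_predP; split=> -[].
apply/allpairsPdep/andP => [[x [b [xN bx ->]]]|[/chain_predP[ga da] /forallP aN]].
  move: xN bx; rewrite mem_below IH => /andP[gx xN].
  move=> /andP[/chain_predP[gb db] /forallP bx]; split; last first.
    apply/forallP => i; case: (unliftP ord0 i) => [j|] ->.
      by rewrite ffun_consS (ltn_trans (bx j)).
    by rewrite ffun_cons0.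
  apply/chain_predP; split.
    by move=> i; case: (unliftP ord0 i) => [j|] ->; rewrite ?ffun_consS ?ffun_cons0.
  move=> i j; case: (unliftP ord0 i) => [i'|] ->; case: (unliftP ord0 j) => [j'|] ->;
    rewrite ?ffun_consS ?ffun_cons0 ?ltnn //.
  by rewrite /= /bump !leq0n !add1n ltnS; exact: db.
exists (a ord0), [ffun i => a (lift ord0 i)]; split.
- by rewrite mem_below ga aN.
- rewrite IH; apply/andP; split.
    apply/chain_predP; split=> [i|i j ij]; rewrite !ffunE //.
    by apply: da; rewrite /= /bump !leq0n !add1n ltnS.
  by apply/forallP => i; rewrite ffunE da.
- apply/ffunP => i; case: (unliftP ord0 i) => [j|] ->.
    by rewrite ffun_consS ffunE.
  by rewrite ffun_cons0.
Qed.

Lemma sum_chains n N (eps : 'I_n -> F) (s : 'I_n -> nat) :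
  \sum_(a <- chains n N) term eps s a = word_sum toKC level_sum eps s N.
Proof.
elim: n N eps s => [|n IH] N eps s /=.
  by rewrite big_seq1 /term big_ord0.
rewrite big_allpairs_dep sum_below; apply: eq_bigr => j _.
rewrite mulrAC /level_sum mulr_sumr; apply: eq_big_seq => x.
rewrite mem_level => /andP[_ /eqP xj].
rewrite -IH xj mulrAC mulr_sumr; apply: eq_bigr => a _.
rewrite /term big_ord_recl ffun_cons0 xj; congr (_ * _).
by apply: eq_bigr => i _; rewrite ffun_consS.
Qed.

Lemma val_ge_term n (eps : 'I_n -> F) (s : 'I_n -> nat) a N :
  (forall i, (0 < s i)%N) -> chain_pred a -> ~~ [forall i, (D (a i) < N)%N] ->
  val_ge N (KtoKinf (term eps s a)).
Proof.
move=> s0 /chain_predP[ga _] /forallPn[i]; rewrite -leqNgt => Ni.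
have vt k : val_ge (D (a k)) (KtoKinf (toK (eps k ^+ D (a k))%:P / toK (den (a k)) ^+ s k)).
  rewrite fmorph_div /= [KtoKinf (_ ^+ _)]rmorphXn /= !KtoKinf_toK -exprVn.
  apply: (@val_ge_AtoKinfM _ _ _ 0); first exact: size_polyC_leq1.
  rewrite addn0; apply: val_geX => //; apply: (val_ge_le (den_deg (ga k))).
  exact/val_ge_AtoKinfV/den_neq0.
rewrite rmorph_prod (bigD1 i) //= -[N]addn0.
apply: val_geM; first exact: (val_ge_le Ni).
elim/big_rec: _ => [|k y _ y0].
  by rewrite -(rmorph1 (@fpsK F)); exact: val_ge_fps.
by rewrite -[0%N]addn0; apply: val_geM => //; exact: (val_ge_le (leq0n _)).
Qed.

(** [P] is kept apart from [chain_pred] because the two index types are cut out by their own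
    predicates. The chains with all levels below [N] exhaust the index set and sum to [word_sum] at
    [N]. *)
Lemma word_sum_converges n (eps : 'I_n -> F) (s : 'I_n -> nat)
    (P : pred {ffun 'I_n -> T}) :
  P =1 @chain_pred n -> (forall i, (0 < s i)%N) ->
  converges (word_sum toKC level_sum eps s)
    (Kinf_sum (fun a : {a | P a} => KtoKinf (term eps s (sval a)))).
Proof.
move=> PE s0; pose x (a : {a | P a}) := KtoKinf (term eps s (sval a)).
pose e N : seq {a | P a} := pmap insub (chains n N).
have eE N : \sum_(a <- e N) x a = KtoKinf (word_sum toKC level_sum eps s N).
  rewrite -sum_chains rmorph_sum.
  rewrite -(big_map (fun a : {a | P a} => sval a) predT
     (fun a => KtoKinf (term eps s a))) /=.
  rewrite /e (pmap_filter (insubK _)); congr (bigop _ _ _).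
  apply/all_filterP/allP => a; rewrite mem_chains isSome_insub PE.
  by case/andP.
have eU N : uniq (e N) by apply: pmap_sub_uniq; exact: chains_uniq.
have memE N a : (a \in e N) = [forall i, (D (sval a i) < N)%N].
  by rewrite mem_pmap_sub mem_chains -PE (valP a).
have xN N a : a \notin e N -> val_ge N (x a).
  by rewrite memE => aN; apply: val_ge_term => //; rewrite -PE (valP a).
(* Passing from [N] to [N.+1] only adds terms of valuation at least [N]. *)
have [N|z zN] := @Kinf_complete F (fun N => \sum_(a <- e N) x a).
  have sub : {subset e N <= e N.+1}.
    move=> a; rewrite !memE => /forallP aN; apply/forallP => i.
    by rewrite ltnS ltnW.
  rewrite (bigID (mem (e N))) /= -[X in X + _ - _]big_filter.
  rewrite (perm_big (e N)) /=; last first.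
    apply: uniq_perm; rewrite ?filter_uniq // => a.
    by rewrite mem_filter; case: (boolP (a \in e N)) => // /sub ->.
  rewrite addrAC subrr add0r; apply: val_ge_sum => a; exact: xN.
rewrite (Kinf_sum_exhaustion eU xN zN) => N; exists N => M NM.
by apply: (val_ge_le NM); rewrite -eE.
Qed.

End Sums.

(** * Comparison of the two spans *)

Section Comparison.
Variable F : finFieldType.
Local Notation q := #|F|.
Local Notation toKC := (@toK F \o @polyC F).
Local Notation t := (toK 'X : K F).

Lemma toK_inj : injective (@toK F).
Proof. by move=> p r /eqP; rewrite /toK tofrac_eq => /eqP. Qed.

Lemma toKX_frob i : (0 < i)%N -> t ^+ (q ^ i) != t.
Proof.
move=> i0; rewrite -rmorphXn /= (inj_eq toK_inj); apply: contraTneq i0.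
move/(congr1 (size : {poly F} -> nat)); rewrite size_polyXn size_polyX => -[] /eqP.
rewrite -[X in _ == X](expn0 q) eqn_exp2l; last exact: card_gt1.
by move=> /eqP ->.
Qed.

Lemma toK_ell d : toK (ell F d) = ellL F t d.
Proof.
elim: d => [|d IH]; first by rewrite /ell big_geq // rmorph1.
rewrite /ell big_nat_recr //= rmorphM /= -[X in toK X]/(ell F d) IH.
by rewrite rmorphB rmorphXn.
Qed.

Lemma ell_neq0 d : ell F d != 0.
Proof.
rewrite -(inj_eq toK_inj) toK_ell rmorph0; apply: ellL_neq0; exact: toKX_frob.
Qed.

Lemma ell_size d : (d <= (size (ell F d)).-1)%N.
Proof.
elim: d => // d IH; have := ell_neq0 d.+1; have := ell_neq0 d.
have -> : ell F d.+1 = ell F d * ('X - 'X^(q ^ d.+1)) by rewrite /ell big_nat_recr.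
move=> n0 nS; have b0 : 'X - 'X^(q ^ d.+1) != 0 :> {poly F}.
  by apply: contraNneq nS => ->; rewrite mulr0.
have q1 : (1 < q ^ d.+1)%N by rewrite -(expn0 q) ltn_exp2l // card_gt1.
have sb : size ('X - 'X^(q ^ d.+1) : {poly F}) = (q ^ d.+1).+1.
  by rewrite addrC size_polyDl size_polyN size_polyXn ?size_polyX.
rewrite size_mul // sb; have : (0 < size (ell F d))%N by rewrite size_poly_gt0.
by move: (q ^ d.+1)%N (size (ell F d)) q1 IH => b m; lia.
Qed.

Definition monic_level d : seq {poly F} :=
  [seq Poly (rcons (val c) 1) | c <- enum {: d.-tuple F}].

Lemma polyseq_monic_level d (c : d.-tuple F) :
  Poly (rcons c 1) = rcons c 1 :> seq F.
Proof. by rewrite (PolyK (c := 0)) // last_rcons oner_neq0. Qed.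

Lemma size_monic_level d : size (monic_level d) = (q ^ d)%N.
Proof. by rewrite size_map -cardE card_tuple. Qed.

Lemma monic_level_uniq d : uniq (monic_level d).
Proof.
rewrite map_inj_uniq ?enum_uniq // => c c' /(congr1 (@polyseq F)).
rewrite !polyseq_monic_level => /rcons_inj[]; exact: val_inj.
Qed.

Lemma mem_monic_level d p : (p \in monic_level d) = (p \is monic) && (deg p == d).
Proof.
apply/mapP/andP => [[c _ ->]|[pm /eqP pd]].
  rewrite monicE lead_coefE /deg polyseq_monic_level size_rcons size_tuple.
  by rewrite nth_rcons size_tuple ltnn eqxx.
have sp : size p = d.+1.
  by rewrite -pd /deg prednK // size_poly_gt0 monic_neq0.
have sz : size (take d p) == d by rewrite size_takel // sp.
exists (Tuple sz); rewrite ?mem_enum //=; apply/val_inj.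
have p1 : p`_d = 1 by move: pm; rewrite monicE lead_coefE sp => /eqP.
rewrite /= -p1 -take_nth ?sp // -{1}sp take_size.
by rewrite polyseqK.
Qed.

(** By linearity over [F] and [carlitz_polyX], only the leading monomial contributes. *)
Lemma carlitz_poly_monic p : p \is monic -> carlitz_poly F t (deg p) (toK p) = 1.
Proof.
move=> pm; have sp : size p = (deg p).+1.
  by rewrite /deg prednK // size_poly_gt0 monic_neq0.
have pE : toK p = \sum_(i < (deg p).+1) toKC p`_i * t ^+ i.
  rewrite -{1}[p]coefK poly_def sp rmorph_sum; apply: eq_bigr => i _.
  by rewrite -mul_polyC rmorphM rmorphXn.
have frob := toKX_frob.
rewrite pE (carlitz_poly_sum toKC).
transitivity (\sum_(i < (deg p).+1) toKC p`_i * (i == deg p :> nat)%:R).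
  apply: eq_bigr => i _; rewrite (carlitz_polyZ toKC) (carlitz_polyX toKC frob) //.
  by rewrite -ltnS.
rewrite big_ord_recr /= eqxx big1 => [|i _]; last by rewrite ltn_eqF ?mulr0.
move: pm; rewrite monicE lead_coefE => /eqP ->.
by rewrite add0r mulr1 rmorph1.
Qed.

Lemma level_sum_ell :
  level_sum (fun d => [:: d]) (@ell F) = powers (inv_ell F t).
Proof.
apply/funext => s; apply/funext => d.
by rewrite /level_sum big_seq1 toK_ell /powers /inv_ell exprVn.
Qed.

Lemma nested_level_sum w f : nested toKC (level_sum monic_level id) w f <->
  nested toKC (level_sum (fun d => [:: d]) (@ell F)) w f.
Proof.
rewrite level_sum_ell.
have -> : level_sum monic_level id = fun s d =>
    \sum_(a <- [seq toK p | p <- monic_level d]) a ^- s.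
  by apply/funext => s; apply/funext => d; rewrite big_map.
apply: nested_power_sums => [|d|d|d a]; first exact: toKX_frob.
- by rewrite map_inj_uniq ?monic_level_uniq //; exact: toK_inj.
- by rewrite size_map size_monic_level.
- case/mapP => p; rewrite mem_monic_level => /andP[pm /eqP <-] ->.
  exact: carlitz_poly_monic.
Qed.

Lemma AMZV_converges n (eps : 'I_n -> F) (s : 'I_n -> nat) :
  (forall i, (0 < s i)%N) ->
  converges (word_sum toKC (level_sum monic_level id) eps s) (AMZV eps s).
Proof.
apply: (@word_sum_converges _ _ (@deg F) (fun p => p \is monic)) => //.
- exact: monic_level_uniq.
- by move=> d x; rewrite mem_monic_level.
- by move=> p; exact: monic_neq0.
Qed.

Lemma ACMPL_converges n (eps : 'I_n -> F) (s : 'I_n -> nat) :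
  (forall i, (0 < s i)%N) ->
  converges (word_sum toKC (level_sum (fun d => [:: d]) (@ell F)) eps s)
    (ACMPL eps s).
Proof.
apply: (@word_sum_converges _ _ id predT) => //.
- by move=> d x; rewrite inE.
- by move=> d _; exact: ell_neq0.
- by move=> d _; exact: ell_size.
- move=> a; rewrite /chain_pred /=; symmetry; apply/andb_idl => _.
  exact/forallP.
Qed.

(** A truncated value for [X] is a combination of truncated values for [X'], with the same
    coefficients at every bound; letting the bound grow, uniqueness of limits carries the relation
    over to [V] and [V']. *)
Lemma linear_span_nested_sub (X X' : nat -> nat -> K F)
    (V V' : forall n, ('I_n -> F) -> ('I_n -> nat) -> Kinf F) w :
  (forall f, nested toKC X w f -> nested toKC X' w f) ->
  (forall n (eps : 'I_n -> F) s, (forall i, (0 < s i)%N) ->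
     converges (word_sum toKC X eps s) (V n eps s)) ->
  (forall n (eps : 'I_n -> F) s, (forall i, (0 < s i)%N) ->
     converges (word_sum toKC X' eps s) (V' n eps s)) ->
  forall z,
    linear_span [set z | exists n (eps : 'I_n -> F) (s : 'I_n -> nat),
      admissible w eps s /\ z = V n eps s]%classic z ->
    linear_span [set z | exists n (eps : 'I_n -> F) (s : 'I_n -> nat),
      admissible w eps s /\ z = V' n eps s]%classic z.
Proof.
move=> XX' XV XV'; apply: linear_span_sub => _ [n [eps [s [adm ->]]]].
have [_ s0 _] := adm.
have := nested_word_span (XX' _ (admissible_nested toKC X adm)).
have := XV _ eps s s0; move: (word_sum _ _ _ _) (V _ _ _) => f y fy fspan.
suff [z zspan fz] : exists2 z, linear_span [set z | exists n
    (eps : 'I_n -> F) (s : 'I_n -> nat), admissible w eps s /\ z = V' n eps s]%classic z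
    & converges f z.
  by rewrite (converges_unique fy fz).
elim: fspan => {n eps s adm s0 f fy} [|c n eps s f adm _ [z zspan fz]].
  by exists 0; [exact: linear_span0 | exact: converges0].
have [_ s0 _] := adm.
exists (c *: V' n eps s + z).
  by apply: linear_span_cons => //; exists n, eps, s.
by apply: converges_lin => //; exact: XV'.
Qed.

End Comparison.

Theorem theorem4p9 (F : finFieldType) (w : nat) (hw : (0 < w)%N) :
  AZ F w = AL F w :> set (Kinf F).
Proof.
apply/seteqP; split.
- apply: linear_span_nested_sub (@AMZV_converges F) (@ACMPL_converges F) => f.
  by move/nested_level_sum.
- apply: linear_span_nested_sub (@ACMPL_converges F) (@AMZV_converges F) => f.
  by move/nested_level_sum.
Qed.
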